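(* Let $(S,R)$ be a $G$-weakly admissible set of $G$-generators and relations. Then there exists a $\nu$-complete lmc $G$-$C^*$-algebra $C^*_{G,\nu}(S,R)$, equipped with a $G$-representation $\rho:S\to C^*_{G,\nu}(S,R)$ of $(S,R)$, such that for any $G$-representation $\sigma$ of $(S,R)$ in a $\nu$-complete lmc $G$-$C^*$-algebra $B$ there exists a unique $G$-equivariant continuous $*$-homomorphism $\varphi:C^*_{G,\nu}(S,R)\to B$ with $\varphi\circ\rho=\sigma$. Moreover, for each $\nu$-complete lmc $G$-$C^*$-algebra $B$, the $G$-equivariant continuous $*$-homomorphisms $C^*_{G,\nu}(S,R)\to B$ are in one-to-one correspondence (via $\varphi\mapsto\varphi\circ\rho$) with the $G$-representations of $(S,R)$ in $B$.
   Context: $G$ is a locally compact, second countable group and $\nu$ is a fixed cardinal with $|\nu|\ge 2^{2^{|\mathbb{N}|}}$. A $C^*$-seminorm is a seminorm $p$ on a $*$-algebra with $p(ab)\le p(a)p(b)$, $p(a^* )=p(a)$, $p(a^*a)=p(a)^2$. A $G$-algebra is a topological $*$-algebra (vector space topology, jointly continuous multiplication, continuous involution) with an action of $G$ by bicontinuous $*$-automorphisms such that $g\mapsto g.a$ is continuous for each $a$. An lmc $G$-$C^*$-algebra is a $G$-algebra whose topology is induced by a family of $G$-invariant $C^*$-seminorms; $\mathcal{S}(A)$ is the set of continuous $G$-invariant $C^*$-seminorms on $A$ and $A_p:=\overline{A/\ker p}$, a $G$-$C^*$-algebra. $\nu$-complete means Hausdorff and every Cauchy $\nu$-sequence (a function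 $\kappa\to A$ with $\kappa\le\nu$ an ordinal, Cauchy in the usual sense) converges. A set of $G$-generators and relations $(S,R)$ consists of a $G$-set $S$ and a collection $R$ of relations on $S$ which make sense for elements of a ($\nu$-complete lmc) $G$-$C^*$-algebra and which includes the relations that the maps $G\ni g\mapsto g.s$ are continuous for all $s\in S$. A $G$-representation of $(S,R)$ in such an algebra $A$ is a $G$-equivariant function $\rho:S\to A$ such that the elements $\rho(s)$, $s\in S$, satisfy the relations $R$ in $A$. (No particular syntax for relations is assumed: $R$ matters only through which $G$-equivariant functions $S\to A$ are $G$-representations.) $(S,R)$ is $G$-weakly admissible if: (1) the zero map from $S$ to the zero $C^*$-algebra is a $G$-representation; (2) if $\rho$ is a $G$-representation in a $\nu$-complete lmc $G$-$C^*$-algebra $A$ and $B$ is a $\nu$-complete lmc $G$-$C^*$-subalgebra of $A$ containing $\rho(S)$, then $\rho$ is a $G$-representation in $B$; (3) if $\rho$ is a $G$-representation in a $\nu$-complete lmc $G$-$C^*$-algebra $A$ and $\varphi:A\to B$ is a continuous ($G$-equivariant $*$-)homomorphism to a $G$-$C^*$-algebra $B$, then $\varphi\circ\rho$ is a $G$-representation in $B$; (4) if $A$ is a $\nu$-complete lmc $G$-$C^*$-algebra and $\rho:S\to A$ is a function such that for every $p\in\mathcal{S}(A)$ the composition of $\rho$ with the canonical map $A\to A_p$ is a $G$-representation in $A_p$, then $\rho$ is a $G$-representation in $A$; (5) if $\rho_1,\dots,\rho_n$ are $G$-representations in $G$-$C^*$-algebras $A_1,\dots,A_n$, then $s\mapsto(\rho_1(s),\dots,\rho_n(s))$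 is a $G$-representation in $A_1\oplus\cdots\oplus A_n$. *)

(* Defs.v *)
From HB Require Import structures.
From mathcomp Require Import all_boot all_order all_algebra.
From mathcomp Require Import finmap complex.
From mathcomp Require Import all_classical all_reals.
From mathcomp Require Import topology normedtype.

Set Implicit Arguments.
Unset Strict Implicit.
Unset Printing Implicit Defensive.

Import Order.TTheory GRing.Theory Num.Theory.
Import numFieldNormedType.Exports.

Local Open Scope classical_set_scope.
Local Open Scope ring_scope.

HB.mixin Record isTopGroup G & Topological G & Group G := {
  mulg_continuous : continuous (fun x : G * G => (x.1 * x.2)%g);
  invg_continuous : continuous (fun x : G => (x^-1)%g)
}.

#[short(type="topGroupType")]
HB.structure Definition TopGroup :=
  {G of Topological G & Group G & isTopGroup G}.

HB.mixin Record isGSet (G : groupType) (S : Type) := {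
  gact : G -> S -> S;
  gact1 : forall s, gact 1%g s = s;
  gactM : forall g h s, gact (g * h)%g s = gact g (gact h s)
}.

#[short(type="gSetType")]
HB.structure Definition GSet (G : groupType) := {S of isGSet G S}.

(* Complex *-algebras, not assumed unital: hence the multiplication amul is not
   that of a MathComp ring. *)
HB.mixin Record Lmodule_isStarAlg (R : realType) A & GRing.Lmodule R[i] A := {
  amul : A -> A -> A;
  astar : A -> A;
  amulA : associative amul;
  amulDl : left_distributive amul +%R;
  amulDr : right_distributive amul +%R;
  amulZl : forall (z : R[i]) a b, amul (z *: a) b = z *: amul a b;
  amulZr : forall (z : R[i]) a b, amul a (z *: b) = z *: amul a b;
  astarK : involutive astar;
  astarD : {morph astar : a b / a + b};
  astarZ : forall (z : R[i]) a, astar (z *: a) = z^* *: astar a;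
  astarM : forall a b, astar (amul a b) = amul (astar b) (astar a)
}.

#[short(type="starAlgType")]
HB.structure Definition StarAlg (R : realType) :=
  {A of GRing.Lmodule R[i] A & Lmodule_isStarAlg R A}.

HB.mixin Record isGStarAlg (R : realType) (G : groupType) A
    & StarAlg R A & GSet G A := {
  gactD : forall (g : G) (a b : A), gact g (a + b) = gact g a + gact g b;
  gactZ : forall (g : G) (z : R[i]) (a : A), gact g (z *: a) = z *: gact g a;
  gact_amul : forall (g : G) (a b : A),
    gact g (amul a b) = amul (gact g a) (gact g b);
  gact_astar : forall (g : G) (a : A), gact g (astar a) = astar (gact g a)
}.

#[short(type="gStarAlgType")]
HB.structure Definition GStarAlg (R : realType) (G : groupType) :=
  {A of StarAlg R A & GSet G A & isGStarAlg R G A}.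

(* Each gact g is bicontinuous, its inverse being gact g^-1. *)
HB.mixin Record isGAlg (R : realType) (G : topGroupType) A
    & GStarAlg R G A & Topological A := {
  amul_continuous : continuous (fun x : A * A => amul x.1 x.2);
  astar_continuous : continuous (astar : A -> A);
  gact_continuous : forall g : G, continuous (gact g : A -> A);
  orbit_continuous : forall a : A, continuous (fun g : G => gact g a)
}.

#[short(type="gAlgType")]
HB.structure Definition GAlg (R : realType) (G : topGroupType) :=
  {A of GStarAlg R G A & TopologicalLmodule R[i] A & isGAlg R G A}.

Section Seminorms.
Context {R : realType}.

Record cstar_seminorm (A : starAlgType R) (p : A -> R) : Prop := {
  cstar_triangle : forall a b, p (a + b) <= p a + p b;
  cstar_homog : forall (z : R[i]) a, p (z *: a) = Normc.normc z * p a;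
  cstar_submul : forall a b, p (amul a b) <= p a * p b;
  cstar_isom : forall a, p (astar a) = p a;
  cstar_id : forall a, p (amul (astar a) a) = p a ^+ 2
}.

Definition ginvariant {G : groupType} {A : gSetType G} (p : A -> R) :=
  forall (g : G) a, p (gact g a) = p a.

Definition sball {A : zmodType} (F : set (A -> R)) (a : A) (e : R) : set A :=
  [set x | forall p, F p -> p (x - a) < e].

Definition snbhs {A : zmodType} (P : set (A -> R)) (a : A) : set_system A :=
  [set U | exists (F : set (A -> R)) (e : R),
    [/\ finite_set F, F `<=` P, 0 < e & sball F a e `<=` U]].

Definition induces_topology {A : topologicalLmodType R[i]}
    (P : set (A -> R)) :=
  forall a : A, nbhs a = snbhs P a.

End Seminorms.

(* Not assumed Hausdorff: that is part of nu_complete below. *)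
HB.mixin Record GAlg_isLmc (R : realType) (G : topGroupType) A & GAlg R G A := {
  lmc_subproof : exists P : set (A -> R),
    (forall p, P p -> cstar_seminorm p /\ ginvariant p) /\ induces_topology P
}.

#[short(type="lmcGCstarType")]
HB.structure Definition LmcGCstar (R : realType) (G : topGroupType) :=
  {A of GAlg R G A & GAlg_isLmc R G A}.

Section StarAlgTheory.
Context {R : realType}.

Lemma amulBl (A : starAlgType R) (a b c : A) :
  amul (a - b) c = amul a c - amul b c.
Proof. by rewrite -[- b]scaleN1r amulDl amulZl scaleN1r. Qed.

Lemma amulBr (A : starAlgType R) (a b c : A) :
  amul a (b - c) = amul a b - amul a c.
Proof. by rewrite -[- c]scaleN1r amulDr amulZr scaleN1r. Qed.

Lemma amulB_split (A : starAlgType R) (a b x y : A) :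
  amul x y - amul a b = amul x (y - b) + amul (x - a) b.
Proof. by rewrite amulBr amulBl addrA subrK. Qed.

Lemma astarB (A : starAlgType R) (a b : A) :
  astar (a - b) = astar a - astar b.
Proof. by rewrite -[- b]scaleN1r astarD astarZ rmorphN1 scaleN1r. Qed.

Lemma gactB (G : groupType) (A : gStarAlgType R G) (g : G) (a b : A) :
  gact g (a - b) = gact g a - gact g b.
Proof. by rewrite -[- b]scaleN1r gactD gactZ scaleN1r. Qed.

End StarAlgTheory.

Section SeminormTheory.
Context {R : realType} {A : starAlgType R} {p : A -> R}.
Hypothesis hp : cstar_seminorm p.

Lemma cstar0 : p 0 = 0.
Proof. by rewrite -(scale0r (0 : A)) (cstar_homog hp) Normc.normc0 mul0r. Qed.

Lemma cstarN a : p (- a) = p a.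
Proof.
rewrite -scaleN1r (cstar_homog hp) (_ : Normc.normc _ = 1) ?mul1r//.
by rewrite /Normc.normc/= oppr0 sqrrN expr1n expr0n addr0 sqrtr1.
Qed.

Lemma cstar_ge0 a : 0 <= p a.
Proof.
have := cstar_triangle hp a (- a).
by rewrite subrr cstar0 cstarN -mulr2n pmulrn_lge0.
Qed.

Lemma cstarB a b : p (a - b) = p (b - a).
Proof. by rewrite -cstarN opprB. Qed.

Lemma cstar_tri c a b : p (a - b) <= p (a - c) + p (c - b).
Proof.
by have := cstar_triangle hp (a - c) (c - b); rewrite addrA subrK.
Qed.

Lemma cstar_dist a b : `|p a - p b| <= p (a - b).
Proof.
have h x y : p x - p y <= p (x - y).
  by rewrite lerBlDr; have := cstar_triangle hp (x - y) y; rewrite subrK.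
by rewrite ler_norml lerNl opprB h andbT cstarB h.
Qed.

End SeminormTheory.

Lemma normc_near {R : realType} (z : R[i]) (e : R) : 0 < e ->
  \forall w \near (z : R[i]^o), Normc.normc (w - z) < e.
Proof.
move=> e0; have e0' : 0 < (e%:C)%C by rewrite ltcR.
have := @nbhsx_ballx _ R[i]^o z _ e0'.
apply: filterS => w; rewrite /ball/= distrC normc_def /=.
by case: (w - z) => a b /=; rewrite ltcR.
Qed.

HB.factory Record GStarAlg_isLmc (R : realType) (G : topGroupType) A
    & GStarAlg R G A := {
  seminorms : set (A -> R);
  seminorms_cstar : forall p, seminorms p -> cstar_seminorm p;
  seminorms_inv : forall p, seminorms p -> ginvariant p;
  seminorms_orbit : forall p, seminorms p -> forall (a : A) (g0 : G) (e : R),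
    0 < e -> \forall g \near g0, p (gact g a - gact g0 a) < e
}.

HB.builders Context R G A & GStarAlg_isLmc R G A.

Let P := seminorms.

Let snbhs_filter (a : A) : ProperFilter (snbhs P a).
Proof.
split.
  case=> F [e [_ FP e0]] /(_ a); apply=> p Fp.
  by rewrite subrr (cstar0 (seminorms_cstar (FP _ Fp))).
split.
- by exists set0, 1; split.
- move=> U V [F [e [fF FP e0 FU]]] [H [d [fH HP d0 HV]]].
  exists (F `|` H), (Num.min e d); split.
  + by rewrite finite_setU.
  + by move=> p [/FP|/HP].
  + by rewrite lt_min e0.
  + move=> x hx; split.
    * apply: FU => p Fp; have := hx _ (or_introl Fp).
      by rewrite lt_min => /andP[].
    * apply: HV => p Fp; have := hx _ (or_intror Fp).
      by rewrite lt_min => /andP[].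
- move=> U V UV [F [e [fF FP e0 FU]]]; exists F, e; split => //.
  exact: subset_trans UV.
Qed.

HB.instance Definition _ := hasNbhs.Build A (snbhs P).

Let snbhs_singleton (a : A) (U : set A) : nbhs a U -> U a.
Proof.
case=> F [e [_ FP e0]] /(_ a); apply=> p Fp.
by rewrite subrr (cstar0 (seminorms_cstar (FP _ Fp))).
Qed.

Let snbhs_nbhs (a : A) (U : set A) : nbhs a U -> nbhs a (nbhs^~ U).
Proof.
case=> F [e [fF FP e0 FU]]; exists F, (e / 2); split => //.
  by rewrite divr_gt0.
move=> x hx; exists F, (e / 2); split => //; first by rewrite divr_gt0.
move=> y hy; apply: FU => p Fp.
apply: le_lt_trans (cstar_tri (seminorms_cstar (FP _ Fp)) x _ _) _.
by rewrite (splitr e) ltrD ?hx ?hy.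
Qed.

HB.instance Definition _ :=
  Nbhs_isNbhsTopological.Build A snbhs_filter snbhs_singleton snbhs_nbhs.

Let snbhs_cvg T (F : set_system T) (f : T -> A) (l : A) : Filter F ->
  (forall p, P p -> forall e, 0 < e -> \forall x \near F, p (f x - l) < e) ->
  f x @[x --> F] --> l.
Proof.
move=> FF h U [H [e [/finite_fsetP[X HX] HP e0 HU]]].
have := @filter_bigI _ _ X (fun p => [set x | p (f x - l) < e]) F FF.
have hX p : p \in X -> P p by move=> pX; apply: HP; rewrite HX.
move=> /(_ (fun p pX => h p (hX p pX) e e0)) hF.
apply: (@filterS _ F FF _ (f @^-1` U) _ hF) => x hx.
by apply: HU => p; rewrite HX => /hx.
Qed.

Let snbhs_near (p : A -> R) (a : A) (e : R) : P p -> 0 < e ->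
  \forall x \near a, p (x - a) < e.
Proof.
move=> Pp e0; exists [set p], e; split => //.
- by move=> q ->.
- by move=> x; apply.
Qed.

Let add_cont : continuous (fun x : A * A => x.1 + x.2).
Proof.
move=> [a b]; apply: snbhs_cvg => p Pp e e0.
have e2 : 0 < e / 2 by rewrite divr_gt0.
exists ([set x | p (x - a) < e / 2], [set x | p (x - b) < e / 2]).
  by split; apply: snbhs_near.
move=> [x y] [/= hx hy]; rewrite opprD addrACA.
apply: le_lt_trans (cstar_triangle (seminorms_cstar Pp) _ _) _.
by rewrite (splitr e) ltrD.
Qed.

HB.instance Definition _ :=
  PreTopologicalNmodule_isTopologicalNmodule.Build A add_cont.

Let scale_cont : continuous (fun z : R[i]^o * A => z.1 *: z.2).
Proof.
move=> [z a]; apply: snbhs_cvg => p Pp e e0.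
have hp := seminorms_cstar Pp.
have M0 : 0 < Normc.normc z + 1.
  by rewrite ltr_wpDl ?ltr01//; case: (z) => ? ?; exact: sqrtr_ge0.
have pa0 : 0 < p a + 1 by rewrite ltr_wpDl ?(cstar_ge0 hp).
pose d1 := Num.min 1 (e / 2 / (p a + 1)).
have d10 : 0 < d1 by rewrite lt_min ltr01 !divr_gt0.
have d20 : 0 < e / 2 / (Normc.normc z + 1) by rewrite !divr_gt0.
exists ([set w : R[i]^o | Normc.normc (w - z) < d1],
        [set x | p (x - a) < e / 2 / (Normc.normc z + 1)]).
  by split; [exact: normc_near|exact: snbhs_near].
move=> [w x] [/= hw hx].
have -> : w *: x - z *: a = w *: (x - a) + (w - z) *: a.
  by rewrite scalerBr scalerBl addrA subrK.
apply: le_lt_trans (cstar_triangle hp _ _) _.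
rewrite !(cstar_homog hp) (splitr e) ltr_leD//.
  have wz : Normc.normc w <= Normc.normc z + 1.
    apply: le_trans (_ : _ <= Normc.normc z + Normc.normc (w - z)) _.
      rewrite -lecR rmorphD/=.
      by have := ler_normD z (w - z); rewrite [z + _]addrC subrK.
    by rewrite lerD2l; move: hw; rewrite lt_min => /andP[/ltW].
  have px0 := cstar_ge0 hp (x - a).
  apply: le_lt_trans (ler_wpM2r px0 wz) _.
  by rewrite mulrC -ltr_pdivlMr.
move: hw; rewrite lt_min => /andP[_ /ltW hw].
apply: le_trans (ler_wpM2r (cstar_ge0 hp a) hw) _.
rewrite mulrAC ler_pdivrMr// ler_wpM2l ?lerDl//.
by rewrite divr_ge0// ltW.
Qed.

HB.instance Definition _ :=
  TopologicalNmodule_isTopologicalLmodule.Build R[i] A scale_cont.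

Let amul_cont : continuous (fun x : A * A => amul x.1 x.2).
Proof.
move=> [a b]; apply: snbhs_cvg => p Pp e e0.
have hp := seminorms_cstar Pp.
have pa0 : 0 < p a + 1 by rewrite ltr_wpDl ?(cstar_ge0 hp).
have pb0 : 0 < p b + 1 by rewrite ltr_wpDl ?(cstar_ge0 hp).
pose d1 := Num.min 1 (e / 2 / (p b + 1)).
have d10 : 0 < d1 by rewrite lt_min ltr01 !divr_gt0.
have d20 : 0 < e / 2 / (p a + 1) by rewrite !divr_gt0.
exists ([set x | p (x - a) < d1], [set x | p (x - b) < e / 2 / (p a + 1)]).
  by split; exact: snbhs_near.
move=> [x y] [/= hx hy].
rewrite amulB_split.
apply: le_lt_trans (cstar_triangle hp _ _) _.
rewrite (splitr e) ltr_leD//.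
  apply: le_lt_trans (cstar_submul hp _ _) _.
  have xa : p x <= p a + 1.
    have := cstar_triangle hp a (x - a).
    rewrite [a + _]addrC subrK => /le_trans; apply.
    by rewrite lerD2l; move: hx; rewrite lt_min => /andP[/ltW].
  apply: le_lt_trans (ler_wpM2r (cstar_ge0 hp (y - b)) xa) _.
  by rewrite mulrC -ltr_pdivlMr.
apply: le_trans (cstar_submul hp _ _) _.
move: hx; rewrite lt_min => /andP[_ /ltW hx].
apply: le_trans (ler_wpM2r (cstar_ge0 hp b) hx) _.
rewrite mulrAC ler_pdivrMr// ler_wpM2l ?lerDl//.
by rewrite divr_ge0// ltW.
Qed.

Let astar_cont : continuous (astar : A -> A).
Proof.
move=> a; apply: (@snbhs_cvg _ (nbhs a) _ _ (nbhs_filter a)) => p Pp e e0.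
apply: (@filterS _ (nbhs a) (nbhs_filter a) _ _ _ (snbhs_near a Pp e0)) => x.
by rewrite -(cstar_isom (seminorms_cstar Pp)) astarB.
Qed.

Let gact_cont (g : G) : continuous (gact g : A -> A).
Proof.
move=> a; apply: (@snbhs_cvg _ (nbhs a) _ _ (nbhs_filter a)) => p Pp e e0.
apply: (@filterS _ (nbhs a) (nbhs_filter a) _ _ _ (snbhs_near a Pp e0)) => x.
by rewrite -(seminorms_inv Pp g) gactB.
Qed.

Let orbit_cont (a : A) : continuous (fun g : G => gact g a).
Proof.
by move=> g0; apply: snbhs_cvg => p Pp e e0; exact: seminorms_orbit.
Qed.

HB.instance Definition _ :=
  isGAlg.Build R G A amul_cont astar_cont gact_cont orbit_cont.

Let lmc : exists P : set (A -> R),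
  (forall p, P p -> cstar_seminorm p /\ ginvariant p) /\ induces_topology P.
Proof.
exists P; split=> // p Pp.
by split; [exact: seminorms_cstar|exact: seminorms_inv].
Qed.

HB.instance Definition _ := GAlg_isLmc.Build R G A lmc.

HB.end.

Definition cseminorms {R : realType} {G : topGroupType} (A : gAlgType R G) :
    set (A -> R) :=
  [set p | [/\ cstar_seminorm p, ginvariant p & continuous p]].
Arguments cseminorms {R G} A _.

Lemma cseminorms_orbit {R : realType} {G : topGroupType} {A : gAlgType R G}
    (p : A -> R) : cseminorms A p -> forall (a : A) (g0 : G) (e : R),
  0 < e -> \forall g \near g0, p (gact g a - gact g0 a) < e.
Proof.
case=> hp _ cp a g0 e e0.
have h : (fun g : G => gact g a - gact g0 a) @ g0 --> (0 : A).
  rewrite -(subrr (gact g0 a)).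
  apply: (@continuous_comp G (A * A)%type A
    (fun g => (gact g a, gact g0 a)) (fun x => x.1 - x.2)).
    by apply: cvg_pair; [exact: orbit_continuous|exact: cvg_cst].
  exact: sub_continuous.
have hp0 : (fun g : G => p (gact g a - gact g0 a)) @ g0 --> (0 : R).
  by rewrite -(cstar0 hp); exact: (continuous_cvg _ (cp 0) h).
by move/cvgrPdist_lt : hp0 => /(_ e e0); apply: filterS => g /=;
  rewrite sub0r normrN ger0_norm ?(cstar_ge0 hp).
Qed.

(* The completion of A / ker p, realized as the Cauchy sequences of (A, p)
   modulo the sequences tending to 0; for a seminorm p this performs the
   quotient by ker p and the completion in one step. *)
Section Completion.
Context {R : realType} {G : topGroupType} {A : gAlgType R G} {p : A -> R}.

Definition pcauchy (u : nat -> A) := forall e : R, 0 < e ->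
  exists N, forall m n, (N <= m)%N -> (N <= n)%N -> p (u m - u n) < e.

Record cauchy_seq := CauchySeq {
  cseq :> nat -> A;
  cseqP : pcauchy cseq
}.

HB.instance Definition _ := gen_eqMixin cauchy_seq.
HB.instance Definition _ := gen_choiceMixin cauchy_seq.

Lemma cauchy_seq_ext (u v : cauchy_seq) : u =1 v -> u = v.
Proof.
case: u v => [u hu] [v hv] /= /funext uv; move: hu hv; rewrite uv => hu hv.
by congr CauchySeq; exact: Prop_irrelevance.
Qed.

Definition pequiv (u v : cauchy_seq) : bool :=
  `[< forall e : R, 0 < e ->
      exists N, forall n, (N <= n)%N -> p (u n - v n) < e >].

Hypothesis hp : cseminorms A p.

Let sp : cstar_seminorm p. Proof. by case: hp. Qed.
Let ip : ginvariant p. Proof. by case: hp. Qed.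

Lemma pequiv_refl : reflexive pequiv.
Proof.
by move=> u; apply/asboolP => e e0; exists 0%N => n _; rewrite subrr (cstar0 sp).
Qed.

Lemma pequiv_sym : symmetric pequiv.
Proof.
suff h u v : pequiv u v -> pequiv v u by move=> u v; apply/idP/idP; exact: h.
move=> /asboolP uv; apply/asboolP => e /uv[N hN].
by exists N => n /hN; rewrite (cstarB sp).
Qed.

Lemma pequiv_trans : transitive pequiv.
Proof.
move=> v u w /asboolP uv /asboolP vw; apply/asboolP => e e0.
have e2 : 0 < e / 2 by rewrite divr_gt0.
have [N hN] := uv _ e2; have [M hM] := vw _ e2.
exists (maxn N M) => n; rewrite geq_max => /andP[/hN h1 /hM h2].
by apply: le_lt_trans (cstar_tri sp (v n) _ _) _; rewrite (splitr e) ltrD.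
Qed.

Canonical pequiv_equiv :=
  EquivRel pequiv pequiv_refl pequiv_sym pequiv_trans.

Definition completion : Type := {eq_quot pequiv_equiv}%qT.

HB.instance Definition _ := Choice.on completion.
HB.instance Definition _ : EqQuotient _ pequiv completion :=
  EqQuotient.on completion.

Local Notation pi u := (\pi_completion u)%qT.

Lemma completionW (x : completion) : exists u, x = pi u.
Proof. by exists (repr x); rewrite reprK. Qed.

Lemma pi_eqP (u v : cauchy_seq) : pi u = pi v <-> pequiv u v.
Proof. by split => [/eqmodP|/eqmodP]. Qed.

Lemma repr_pequiv (u : cauchy_seq) : pequiv (repr (pi u)) u.
Proof. by apply/pi_eqP; rewrite reprK. Qed.

Lemma pcauchy_cst (a : A) : pcauchy (fun _ => a).
Proof. by move=> e e0; exists 0%N => *; rewrite subrr (cstar0 sp). Qed.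

Lemma pcauchyD (u v : cauchy_seq) : pcauchy (fun n => u n + v n).
Proof.
move=> e e0; have e2 : 0 < e / 2 by rewrite divr_gt0.
have [N hN] := cseqP u e2; have [M hM] := cseqP v e2.
exists (maxn N M) => m n; rewrite !geq_max => /andP[Nm Mm] /andP[Nn Mn].
rewrite opprD addrACA.
apply: le_lt_trans (cstar_triangle sp _ _) _.
by rewrite (splitr e) ltrD ?hN ?hM.
Qed.

Lemma pcauchy_lip (f : A -> A) (u : cauchy_seq) (k : R) : 0 <= k ->
  (forall a b, p (f a - f b) <= k * p (a - b)) -> pcauchy (fun n => f (u n)).
Proof.
move=> k0 hf e e0; have k1 : 0 < k + 1 by rewrite ltr_wpDl.
have [N hN] := cseqP u (divr_gt0 e0 k1); exists N => m n Nm Nn.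
apply: le_lt_trans (hf _ _) _.
apply: le_lt_trans (_ : _ <= (k + 1) * p (u m - u n)) _.
  by rewrite ler_wpM2r ?(cstar_ge0 sp)// lerDl.
by rewrite mulrC -ltr_pdivlMr// hN.
Qed.

Lemma pequiv_lip (f : A -> A) (u v u' v' : cauchy_seq) (k : R) : 0 <= k ->
  (forall a b, p (f a - f b) <= k * p (a - b)) ->
  (forall n, u' n = f (u n)) -> (forall n, v' n = f (v n)) ->
  pequiv u v -> pequiv u' v'.
Proof.
move=> k0 hf hu hv /asboolP uv; apply/asboolP => e e0.
have k1 : 0 < k + 1 by rewrite ltr_wpDl.
have [N hN] := uv _ (divr_gt0 e0 k1); exists N => n Nn; rewrite hu hv.
apply: le_lt_trans (hf _ _) _.
apply: le_lt_trans (_ : _ <= (k + 1) * p (u n - v n)) _.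
  by rewrite ler_wpM2r ?(cstar_ge0 sp)// lerDl.
by rewrite mulrC -ltr_pdivlMr// hN.
Qed.

Lemma cauchy_seq_bound (u : cauchy_seq) :
  exists2 M, 0 < M & forall n, p (u n) <= M.
Proof.
have [N hN] := cseqP u ltr01.
exists (\sum_(i < N) p (u i) + (p (u N) + 1)).
  by rewrite ltr_wpDl ?sumr_ge0// ?ltr_wpDl// => *; rewrite (cstar_ge0 sp).
move=> n; have [nN|Nn] := ltnP n N.
  rewrite (bigD1 (Ordinal nN))//= -addrA lerDl addr_ge0//.
    by rewrite sumr_ge0 // => *; rewrite (cstar_ge0 sp).
  by rewrite addr_ge0// (cstar_ge0 sp).
have := cstar_triangle sp (u N) (u n - u N).
rewrite [u N + _]addrC subrK => /le_trans; apply.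
apply: ler_wpDl; first by rewrite sumr_ge0// => *; exact: (cstar_ge0 sp).
by rewrite lerD2l ltW// hN.
Qed.

Lemma mul_small (a b x y : A) (M e : R) : 0 < M -> 0 < e ->
  p x <= M -> p b <= M -> p (x - a) < e / (2 * M) -> p (y - b) < e / (2 * M) ->
  p (amul x y - amul a b) < e.
Proof.
move=> M0 e0 xM bM xa yb; rewrite amulB_split.
apply: le_lt_trans (cstar_triangle sp _ _) _; rewrite (splitr e).
have eM : e / 2 = M * (e / (2 * M)) 
  by rewrite invfM mulrCA [M * _]mulrCA divff ?mulr1// gt_eqF.
rewrite ltrD// eM; apply: le_lt_trans (cstar_submul sp _ _) _.
  apply: le_lt_trans (ler_wpM2r (cstar_ge0 sp _) xM) _.
  by rewrite ltr_pM2l.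
rewrite mulrC; apply: le_lt_trans (ler_wpM2r (cstar_ge0 sp _) bM) _.
by rewrite ltr_pM2l.
Qed.

Lemma pcauchyM (u v : cauchy_seq) : pcauchy (fun n => amul (u n) (v n)).
Proof.
move=> e e0; have [M M0 hM] := cauchy_seq_bound u.
have [M' M'0 hM'] := cauchy_seq_bound v; pose K := Num.max M M'.
have K0 : 0 < K by rewrite lt_max M0.
have e' : 0 < e / (2 * K) by rewrite divr_gt0// mulr_gt0.
have [N1 h1] := cseqP u e'; have [N2 h2] := cseqP v e'.
exists (maxn N1 N2) => m n; rewrite !geq_max => /andP[m1 m2] /andP[n1 n2].
by apply: (mul_small K0 e0); rewrite ?h1 ?h2// le_max ?hM ?hM' ?orbT.
Qed.

Lemma pequivM (u v u' v' : cauchy_seq) : pequiv u u' -> pequiv v v' ->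
  pequiv (CauchySeq (pcauchyM u v)) (CauchySeq (pcauchyM u' v')).
Proof.
move=> /asboolP uu /asboolP vv; apply/asboolP => e e0 /=.
have [M M0 hM] := cauchy_seq_bound u.
have [M' M'0 hM'] := cauchy_seq_bound v'; pose K := Num.max M M'.
have K0 : 0 < K by rewrite lt_max M0.
have e' : 0 < e / (2 * K) by rewrite divr_gt0// mulr_gt0.
have [N1 h1] := uu _ e'; have [N2 h2] := vv _ e'.
exists (maxn N1 N2) => n; rewrite !geq_max => /andP[n1 n2].
by apply: (mul_small K0 e0); rewrite ?h1 ?h2// le_max ?hM ?hM' ?orbT.
Qed.

Lemma pequivD (u v u' v' : cauchy_seq) : pequiv u u' -> pequiv v v' ->
  pequiv (CauchySeq (pcauchyD u v)) (CauchySeq (pcauchyD u' v')).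
Proof.
move=> /asboolP uu /asboolP vv; apply/asboolP => e e0 /=.
have e2 : 0 < e / 2 by rewrite divr_gt0.
have [N1 h1] := uu _ e2; have [N2 h2] := vv _ e2.
exists (maxn N1 N2) => n; rewrite !geq_max => /andP[n1 n2].
rewrite opprD addrACA; apply: le_lt_trans (cstar_triangle sp _ _) _.
by rewrite (splitr e) ltrD ?h1 ?h2.
Qed.

Let lipZ (z : R[i]) a b : p (z *: a - z *: b) <= Normc.normc z * p (a - b).
Proof. by rewrite -scalerBr (cstar_homog sp). Qed.

Let normc_ge0 (z : R[i]) : 0 <= Normc.normc z.
Proof. by case: z => ? ?; exact: sqrtr_ge0. Qed.

Let lip_star a b : p (astar a - astar b) <= 1 * p (a - b).
Proof. by rewrite -astarB (cstar_isom sp) mul1r. Qed.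

Let lip_act (g : G) a b : p (gact g a - gact g b) <= 1 * p (a - b).
Proof. by rewrite -gactB ip mul1r. Qed.

Definition seq_cst (a : A) := CauchySeq (pcauchy_cst a).
Definition seq_add (u v : cauchy_seq) := CauchySeq (pcauchyD u v).
Definition seq_mul (u v : cauchy_seq) := CauchySeq (pcauchyM u v).
Definition seq_scale (z : R[i]) (u : cauchy_seq) :=
  CauchySeq (pcauchy_lip u (normc_ge0 z) (lipZ z)).
Definition seq_star (u : cauchy_seq) :=
  CauchySeq (pcauchy_lip u ler01 lip_star).
Definition seq_act (g : G) (u : cauchy_seq) :=
  CauchySeq (pcauchy_lip u ler01 (lip_act g)).

Definition to_completion (a : A) : completion := pi (seq_cst a).

Definition c_add (x y : completion) := pi (seq_add (repr x) (repr y)).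
Definition c_mul (x y : completion) := pi (seq_mul (repr x) (repr y)).
Definition c_scale (z : R[i]) (x : completion) := pi (seq_scale z (repr x)).
Definition c_star (x : completion) := pi (seq_star (repr x)).
Definition c_act (g : G) (x : completion) := pi (seq_act g (repr x)).

Lemma c_addE u v : c_add (pi u) (pi v) = pi (seq_add u v).
Proof. by apply/pi_eqP/pequivD; exact: repr_pequiv. Qed.

Lemma c_mulE u v : c_mul (pi u) (pi v) = pi (seq_mul u v).
Proof. by apply/pi_eqP/pequivM; exact: repr_pequiv. Qed.

Lemma c_scaleE z u : c_scale z (pi u) = pi (seq_scale z u).
Proof.
by apply/pi_eqP/(pequiv_lip (normc_ge0 z) (lipZ z)) => //; exact: repr_pequiv.
Qed.

Lemma c_starE u : c_star (pi u) = pi (seq_star u).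
Proof.
by apply/pi_eqP/(pequiv_lip ler01 lip_star) => //; exact: repr_pequiv.
Qed.

Lemma c_actE g u : c_act g (pi u) = pi (seq_act g u).
Proof.
by apply/pi_eqP/(pequiv_lip ler01 (lip_act g)) => //; exact: repr_pequiv.
Qed.

Local Ltac lift_seq :=
  rewrite ?(c_addE, c_mulE, c_scaleE, c_starE, c_actE);
  congr (\pi_completion _)%qT; apply: cauchy_seq_ext => n /=.

Let c_addA : associative c_add.
Proof.
move=> x y z.
have [u ->] := completionW x; have [v ->] := completionW y.
by have [w ->] := completionW z; lift_seq; rewrite addrA.
Qed.

Let c_addC : commutative c_add.
Proof.
move=> x y; have [u ->] := completionW x; have [v ->] := completionW y.
by lift_seq; rewrite addrC.
Qed.

Let c_add0 : left_id (to_completion 0) c_add.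
Proof.
by move=> x; have [u ->] := completionW x; lift_seq; rewrite add0r.
Qed.

Let c_addN : left_inverse (to_completion 0) (c_scale (-1)) c_add.
Proof.
by move=> x; have [u ->] := completionW x; lift_seq; rewrite scaleN1r addNr.
Qed.

HB.instance Definition _ :=
  GRing.isZmodule.Build completion c_addA c_addC c_add0 c_addN.

Let c_scaleA (z w : R[i]) x : c_scale z (c_scale w x) = c_scale (z * w) x.
Proof. by have [u ->] := completionW x; lift_seq; rewrite scalerA. Qed.

Let c_scale1 : left_id 1 c_scale.
Proof. by move=> x; have [u ->] := completionW x; lift_seq; rewrite scale1r. Qed.

Let c_scaleDr : right_distributive c_scale +%R.
Proof.
move=> z x y; have [u ->] := completionW x; have [v ->] := completionW y.
by rewrite /GRing.add/=; lift_seq; rewrite scalerDr.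
Qed.

Let c_scaleDl x : {morph c_scale^~ x : z w / z + w}.
Proof.
move=> z w; have [u ->] := completionW x.
by rewrite [RHS]/GRing.add/=; lift_seq; rewrite scalerDl.
Qed.

HB.instance Definition _ := GRing.Zmodule_isLmodule.Build R[i] completion
  c_scaleA c_scale1 c_scaleDr c_scaleDl.

Let cD u v : pi u + pi v = pi (seq_add u v).
Proof. exact: c_addE. Qed.

Let cZ (z : R[i]) u : z *: pi u = pi (seq_scale z u).
Proof. exact: c_scaleE. Qed.

Let cE := (cD, cZ, c_mulE, c_starE, c_actE).

Local Ltac lift :=
  rewrite ?cE; congr (\pi_completion _)%qT; apply: cauchy_seq_ext => n /=.

Let c_mulA : associative c_mul.
Proof.
move=> x y z.
have [u ->] := completionW x; have [v ->] := completionW y.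
by have [w ->] := completionW z; lift; rewrite amulA.
Qed.

Let c_mulDl : left_distributive c_mul +%R.
Proof.
move=> x y z.
have [u ->] := completionW x; have [v ->] := completionW y.
by have [w ->] := completionW z; lift; rewrite amulDl.
Qed.

Let c_mulDr : right_distributive c_mul +%R.
Proof.
move=> x y z.
have [u ->] := completionW x; have [v ->] := completionW y.
by have [w ->] := completionW z; lift; rewrite amulDr.
Qed.

Let c_mulZl (z : R[i]) x y : c_mul (z *: x) y = z *: c_mul x y.
Proof.
have [u ->] := completionW x; have [v ->] := completionW y.
by lift; rewrite amulZl.
Qed.

Let c_mulZr (z : R[i]) x y : c_mul x (z *: y) = z *: c_mul x y.
Proof.
have [u ->] := completionW x; have [v ->] := completionW y.
by lift; rewrite amulZr.
Qed.

Let c_starK : involutive c_star.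
Proof. by move=> x; have [u ->] := completionW x; lift; rewrite astarK. Qed.

Let c_starD : {morph c_star : x y / x + y}.
Proof.
move=> x y; have [u ->] := completionW x; have [v ->] := completionW y.
by lift; rewrite astarD.
Qed.

Let c_starZ (z : R[i]) x : c_star (z *: x) = z^* *: c_star x.
Proof. by have [u ->] := completionW x; lift; rewrite astarZ. Qed.

Let c_starM x y : c_star (c_mul x y) = c_mul (c_star y) (c_star x).
Proof.
have [u ->] := completionW x; have [v ->] := completionW y.
by lift; rewrite astarM.
Qed.

HB.instance Definition _ := Lmodule_isStarAlg.Build R completion
  c_mulA c_mulDl c_mulDr c_mulZl c_mulZr c_starK c_starD c_starZ c_starM.

Let c_act1 x : c_act 1%g x = x.
Proof. by have [u ->] := completionW x; lift; rewrite gact1. Qed.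

Let c_actM g h x : c_act (g * h)%g x = c_act g (c_act h x).
Proof. by have [u ->] := completionW x; lift; rewrite gactM. Qed.

HB.instance Definition _ := isGSet.Build G completion c_act1 c_actM.

Let c_actD (g : G) (x y : completion) :
  c_act g (x + y) = c_act g x + c_act g y.
Proof.
have [u ->] := completionW x; have [v ->] := completionW y.
by lift; rewrite gactD.
Qed.

Let c_actZ (g : G) (z : R[i]) (x : completion) :
  c_act g (z *: x) = z *: c_act g x.
Proof. by have [u ->] := completionW x; lift; rewrite gactZ. Qed.

Let c_act_mul (g : G) (x y : completion) :
  c_act g (c_mul x y) = c_mul (c_act g x) (c_act g y).
Proof.
have [u ->] := completionW x; have [v ->] := completionW y.
by lift; rewrite gact_amul.
Qed.

Let c_act_star (g : G) (x : completion) :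
  c_act g (c_star x) = c_star (c_act g x).
Proof. by have [u ->] := completionW x; lift; rewrite gact_astar. Qed.

HB.instance Definition _ := isGStarAlg.Build R G completion
  c_actD c_actZ c_act_mul c_act_star.

Definition cnorm (x : completion) : R := lim (p (repr x n) @[n --> \oo]).

Lemma cvg_cauchy_seq (u : cauchy_seq) : cvg (p (u n) @[n --> \oo]).
Proof.
apply/cauchy_cvgP/cauchy_exP => e /(cseqP u)[N hN].
exists (p (u N)); exists N => // n /= Nn; rewrite /ball/=.
by apply: le_lt_trans (cstar_dist sp _ _) _; exact: hN.
Qed.

Lemma cvg_cnorm (u : cauchy_seq) : p (u n) @[n --> \oo] --> cnorm (pi u).
Proof.
have /asboolP ru := repr_pequiv u.
apply/cvgrPdist_lt => e e0; have e2 : 0 < e / 2 by rewrite divr_gt0.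
have h : p (repr (pi u) n) @[n --> \oo] --> cnorm (pi u).
  exact: cvg_cauchy_seq.
move/cvgrPdist_lt : h => /(_ _ e2)[N _ hN].
have [M hM] := ru _ e2.
exists (maxn N M) => // n /=; rewrite geq_max => /andP[/hN h1 /hM h2].
apply: le_lt_trans (ler_distD (p (repr (pi u) n)) _ _) _.
rewrite (splitr e) ltrD//.
exact: le_lt_trans (cstar_dist sp _ _) _.
Qed.

Arguments cvg_cnorm u : clear implicits.

Lemma cnormE (u : cauchy_seq) (l : R) :
  p (u n) @[n --> \oo] --> l -> cnorm (pi u) = l.
Proof.
move=> h; rewrite -(cvg_lim (@Rhausdorff R) h).
by rewrite (cvg_lim (@Rhausdorff R) (cvg_cnorm u)).
Qed.

Lemma cnorm_cst (a : A) : cnorm (to_completion a) = p a.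
Proof. by apply: (@cnormE (seq_cst a)); rewrite /seq_cst/=; exact: cvg_cst. Qed.

Let cnorm_cstar : cstar_seminorm cnorm.
Proof.
split.
- move=> x y; have [u ->] := completionW x; have [v ->] := completionW y.
  rewrite cD; apply: ler_cvg_to (cvg_cnorm _)
    (cvgD (cvg_cnorm u) (cvg_cnorm v)) _.
  by apply: nearW => n; exact: (cstar_triangle sp).
- move=> z x; have [u ->] := completionW x; rewrite cZ.
  apply: cnormE => /=; under eq_fun do rewrite (cstar_homog sp).
  by apply: cvgMr; exact: cvg_cnorm.
- move=> x y; have [u ->] := completionW x; have [v ->] := completionW y.
  rewrite /amul/= c_mulE; apply: ler_cvg_to (cvg_cnorm _)
    (cvgM (cvg_cnorm u) (cvg_cnorm v)) _.
  by apply: nearW => n; exact: (cstar_submul sp).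
- move=> x; have [u ->] := completionW x; rewrite /astar/= c_starE.
  apply: cnormE => /=; under eq_fun do rewrite (cstar_isom sp).
  exact: cvg_cnorm.
- move=> x; have [u ->] := completionW x; rewrite /amul/astar/= c_starE c_mulE.
  apply: cnormE => /=; under eq_fun do rewrite (cstar_id sp) expr2.
  by rewrite expr2; apply: cvgM; exact: cvg_cnorm.
Qed.

Let cnorm_inv : ginvariant cnorm.
Proof.
move=> g x; have [u ->] := completionW x; rewrite /gact/= c_actE.
apply: cnormE => /=; under eq_fun do rewrite ip.
exact: cvg_cnorm.
Qed.

Let cnorm_orbit (x : completion) (g0 : G) (e : R) : 0 < e ->
  \forall g \near g0, cnorm (gact g x - gact g0 x) < e.
Proof.
have [u ->] := completionW x => e0.
have e4 : 0 < e / 4 by rewrite divr_gt0.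
have [N hN] := cseqP u e4.
apply: filterS (cseminorms_orbit hp (u N) g0 e4) => g hg.
rewrite /gact/= !c_actE -[- _]scaleN1r cZ cD.
apply: le_lt_trans (_ : _ <= e / 4 + e / 4 + e / 4) _; last first.
  by rewrite -!mulrDl ltr_pdivrMr// -!mulr2n -mulrSr mulr_natr ltr_pMn2l.
apply: ler_cvg_to (cvg_cnorm _) (cvg_cst _) _.
exists N => // n /= Nn; rewrite scaleN1r.
apply: le_trans (cstar_tri sp (gact g0 (u N)) _ _) _.
rewrite lerD//.
  apply: le_trans (cstar_tri sp (gact g (u N)) _ _) _.
  by rewrite lerD// -?gactB ?ip ltW// hN.
by rewrite -gactB ip ltW// hN.
Qed.

Let cnorm1_cstar q : [set cnorm] q -> cstar_seminorm q.
Proof. by move=> ->. Qed.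

Let cnorm1_inv q : [set cnorm] q -> ginvariant q.
Proof. by move=> ->. Qed.

Let cnorm1_orbit q : [set cnorm] q ->
  forall (x : completion) (g0 : G) (e : R), 0 < e ->
  \forall g \near g0, q (gact g x - gact g0 x) < e.
Proof. by move=> ->. Qed.

HB.instance Definition _ := GStarAlg_isLmc.Build R G completion
  cnorm1_cstar cnorm1_inv cnorm1_orbit.

End Completion.
Arguments pcauchy {R G A} p u.

Record gSubalg {R : realType} {G : topGroupType} (A : lmcGCstarType R G) :=
    GSubalg {
  gsub_set :> set A;
  gsub0 : gsub_set 0;
  gsubD : forall a b, gsub_set a -> gsub_set b -> gsub_set (a + b);
  gsubZ : forall (z : R[i]) a, gsub_set a -> gsub_set (z *: a);
  gsubM : forall a b, gsub_set a -> gsub_set b -> gsub_set (amul a b);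
  gsub_star : forall a, gsub_set a -> gsub_set (astar a);
  gsub_act : forall (g : G) a, gsub_set a -> gsub_set (gact g a)
}.

(* A subalgebra as an algebra of its own: the operations are the restricted
   ones, and the restrictions of the continuous invariant C*-seminorms of A
   induce the subspace topology. *)
Section Subalgebra.
Context {R : realType} {G : topGroupType} {A : lmcGCstarType R G}.
Variable B : gSubalg A.

Definition subalg : Type := set_type B.

HB.instance Definition _ := Choice.on subalg.

Definition subalg_val (x : subalg) : A := val x.
Definition subalg_in (a : A) (h : gsub_set B a) : subalg := exist _ a (mem_set h).

Let valB (x : subalg) : gsub_set B (subalg_val x).
Proof. exact: set_valP. Qed.

Let val_inj : injective subalg_val.
Proof. exact: val_inj. Qed.

Definition s_zero := subalg_in (gsub0 B).
Definition s_add (x y : subalg) := subalg_in (gsubD (valB x) (valB y)).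
Definition s_scale (z : R[i]) (x : subalg) := subalg_in (gsubZ z (valB x)).
Definition s_mul (x y : subalg) := subalg_in (gsubM (valB x) (valB y)).
Definition s_star (x : subalg) := subalg_in (gsub_star (valB x)).
Definition s_act (g : G) (x : subalg) := subalg_in (gsub_act g (valB x)).

Let s_addA : associative s_add.
Proof. by move=> x y z; apply: val_inj; exact: addrA. Qed.
Let s_addC : commutative s_add.
Proof. by move=> x y; apply: val_inj; exact: addrC. Qed.
Let s_add0 : left_id s_zero s_add.
Proof. by move=> x; apply: val_inj; exact: add0r. Qed.
Let s_addN : left_inverse s_zero (s_scale (-1)) s_add.
Proof.
move=> x; apply: val_inj.
by rewrite [LHS](_ : _ = -1 *: subalg_val x + subalg_val x)// scaleN1r addNr.
Qed.

HB.instance Definition _ :=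
  GRing.isZmodule.Build subalg s_addA s_addC s_add0 s_addN.

Let s_scaleA (z w : R[i]) x : s_scale z (s_scale w x) = s_scale (z * w) x.
Proof. by apply: val_inj; exact: scalerA. Qed.
Let s_scale1 : left_id 1 s_scale.
Proof. by move=> x; apply: val_inj; exact: scale1r. Qed.
Let s_scaleDr : right_distributive s_scale +%R.
Proof. by move=> z x y; apply: val_inj; exact: scalerDr. Qed.
Let s_scaleDl x : {morph s_scale^~ x : z w / z + w}.
Proof. by move=> z w; apply: val_inj; exact: scalerDl. Qed.

HB.instance Definition _ := GRing.Zmodule_isLmodule.Build R[i] subalg
  s_scaleA s_scale1 s_scaleDr s_scaleDl.

Let s_mulA : associative s_mul.
Proof. by move=> x y z; apply: val_inj; exact: amulA. Qed.
Let s_mulDl : left_distributive s_mul +%R.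
Proof. by move=> x y z; apply: val_inj; exact: amulDl. Qed.
Let s_mulDr : right_distributive s_mul +%R.
Proof. by move=> x y z; apply: val_inj; exact: amulDr. Qed.
Let s_mulZl (z : R[i]) x y : s_mul (z *: x) y = z *: s_mul x y.
Proof. by apply: val_inj; exact: amulZl. Qed.
Let s_mulZr (z : R[i]) x y : s_mul x (z *: y) = z *: s_mul x y.
Proof. by apply: val_inj; exact: amulZr. Qed.
Let s_starK : involutive s_star.
Proof. by move=> x; apply: val_inj; exact: astarK. Qed.
Let s_starD : {morph s_star : x y / x + y}.
Proof. by move=> x y; apply: val_inj; exact: astarD. Qed.
Let s_starZ (z : R[i]) x : s_star (z *: x) = z^* *: s_star x.
Proof. by apply: val_inj; exact: astarZ. Qed.
Let s_starM x y : s_star (s_mul x y) = s_mul (s_star y) (s_star x).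
Proof. by apply: val_inj; exact: astarM. Qed.

HB.instance Definition _ := Lmodule_isStarAlg.Build R subalg
  s_mulA s_mulDl s_mulDr s_mulZl s_mulZr s_starK s_starD s_starZ s_starM.

Let s_act1 x : s_act 1%g x = x.
Proof. by apply: val_inj; exact: gact1. Qed.
Let s_actM g h x : s_act (g * h)%g x = s_act g (s_act h x).
Proof. by apply: val_inj; exact: gactM. Qed.

HB.instance Definition _ := isGSet.Build G subalg s_act1 s_actM.

Let s_actD (g : G) (x y : subalg) : s_act g (x + y) = s_act g x + s_act g y.
Proof. by apply: val_inj; exact: gactD. Qed.
Let s_actZ (g : G) (z : R[i]) (x : subalg) :
  s_act g (z *: x) = z *: s_act g x.
Proof. by apply: val_inj; exact: gactZ. Qed.
Let s_act_mul (g : G) (x y : subalg) :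
  s_act g (s_mul x y) = s_mul (s_act g x) (s_act g y).
Proof. by apply: val_inj; exact: gact_amul. Qed.
Let s_act_star (g : G) (x : subalg) : s_act g (s_star x) = s_star (s_act g x).
Proof. by apply: val_inj; exact: gact_astar. Qed.

HB.instance Definition _ := isGStarAlg.Build R G subalg
  s_actD s_actZ s_act_mul s_act_star.

Definition subalg_seminorms : set (subalg -> R) :=
  [set q | exists2 p, cseminorms A p & q = p \o subalg_val].

Let subalg_valB x y : subalg_val (x - y) = subalg_val x - subalg_val y.
Proof. by rewrite -[- subalg_val y]scaleN1r. Qed.

Let s_cstar q : subalg_seminorms q -> cstar_seminorm q.
Proof.
case=> p [hp _ _] ->; split=> /=.
- by move=> x y; exact: (cstar_triangle hp).
- by move=> z x; exact: (cstar_homog hp).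
- by move=> x y; exact: (cstar_submul hp).
- by move=> x; exact: (cstar_isom hp).
- by move=> x; exact: (cstar_id hp).
Qed.

Let s_inv q : subalg_seminorms q -> ginvariant q.
Proof. by case=> p [_ ip _] -> g x; exact: ip. Qed.

Let s_orbit q : subalg_seminorms q ->
  forall (x : subalg) (g0 : G) (e : R), 0 < e ->
  \forall g \near g0, q (gact g x - gact g0 x) < e.
Proof.
case=> p hp -> x g0 e e0.
apply: filterS (cseminorms_orbit hp (subalg_val x) g0 e0) => g.
by rewrite /= subalg_valB.
Qed.

HB.instance Definition _ := GStarAlg_isLmc.Build R G subalg
  s_cstar s_inv s_orbit.

End Subalgebra.

(* The product topology is induced by the seminorms of the factors; for
   finitely many G-C*-algebras it is the topology of the max norm, so that the
   product is their direct sum. *)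
Section Product.
Context {R : realType} {G : topGroupType}.
Variables (I : Type) (A : I -> lmcGCstarType R G).

Definition gprod : Type := forall i, A i.

HB.instance Definition _ := gen_eqMixin gprod.
HB.instance Definition _ := gen_choiceMixin gprod.

Let ext (x y : gprod) : (forall i, x i = y i) -> x = y.
Proof. by move=> h; apply: functional_extensionality_dep. Qed.

Definition m_add (x y : gprod) : gprod := fun i => x i + y i.
Definition m_opp (x : gprod) : gprod := fun i => - x i.
Definition m_scale (z : R[i]) (x : gprod) : gprod := fun i => z *: x i.
Definition m_mul (x y : gprod) : gprod := fun i => amul (x i) (y i).
Definition m_star (x : gprod) : gprod := fun i => astar (x i).
Definition m_act (g : G) (x : gprod) : gprod := fun i => gact g (x i).

Let m_addA : associative m_add.
Proof. by move=> x y z; apply: ext => i; exact: addrA. Qed.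
Let m_addC : commutative m_add.
Proof. by move=> x y; apply: ext => i; exact: addrC. Qed.
Let m_add0 : left_id (fun i => 0 : A i) m_add.
Proof. by move=> x; apply: ext => i; exact: add0r. Qed.
Let m_addN : left_inverse (fun i => 0 : A i) m_opp m_add.
Proof. by move=> x; apply: ext => i; exact: addNr. Qed.

HB.instance Definition _ :=
  GRing.isZmodule.Build gprod m_addA m_addC m_add0 m_addN.

Let m_scaleA (z w : R[i]) x : m_scale z (m_scale w x) = m_scale (z * w) x.
Proof. by apply: ext => i; exact: scalerA. Qed.
Let m_scale1 : left_id 1 m_scale.
Proof. by move=> x; apply: ext => i; exact: scale1r. Qed.
Let m_scaleDr : right_distributive m_scale +%R.
Proof. by move=> z x y; apply: ext => i; exact: scalerDr. Qed.
Let m_scaleDl x : {morph m_scale^~ x : z w / z + w}.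
Proof. by move=> z w; apply: ext => i; exact: scalerDl. Qed.

HB.instance Definition _ := GRing.Zmodule_isLmodule.Build R[i] gprod
  m_scaleA m_scale1 m_scaleDr m_scaleDl.

Let m_mulA : associative m_mul.
Proof. by move=> x y z; apply: ext => i; exact: amulA. Qed.
Let m_mulDl : left_distributive m_mul +%R.
Proof. by move=> x y z; apply: ext => i; exact: amulDl. Qed.
Let m_mulDr : right_distributive m_mul +%R.
Proof. by move=> x y z; apply: ext => i; exact: amulDr. Qed.
Let m_mulZl (z : R[i]) (x y : gprod) : m_mul (z *: x) y = z *: m_mul x y.
Proof. by apply: ext => i; exact: amulZl. Qed.
Let m_mulZr (z : R[i]) (x y : gprod) : m_mul x (z *: y) = z *: m_mul x y.
Proof. by apply: ext => i; exact: amulZr. Qed.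
Let m_starK : involutive m_star.
Proof. by move=> x; apply: ext => i; exact: astarK. Qed.
Let m_starD : {morph m_star : x y / x + y}.
Proof. by move=> x y; apply: ext => i; exact: astarD. Qed.
Let m_starZ (z : R[i]) (x : gprod) : m_star (z *: x) = z^* *: m_star x.
Proof. by apply: ext => i; exact: astarZ. Qed.
Let m_starM x y : m_star (m_mul x y) = m_mul (m_star y) (m_star x).
Proof. by apply: ext => i; exact: astarM. Qed.

HB.instance Definition _ := Lmodule_isStarAlg.Build R gprod
  m_mulA m_mulDl m_mulDr m_mulZl m_mulZr m_starK m_starD m_starZ m_starM.

Let m_act1 x : m_act 1%g x = x.
Proof. by apply: ext => i; exact: gact1. Qed.
Let m_actM g h x : m_act (g * h)%g x = m_act g (m_act h x).
Proof. by apply: ext => i; exact: gactM. Qed.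

HB.instance Definition _ := isGSet.Build G gprod m_act1 m_actM.

Let m_actD (g : G) (x y : gprod) : m_act g (x + y) = m_act g x + m_act g y.
Proof. by apply: ext => i; exact: gactD. Qed.
Let m_actZ (g : G) (z : R[i]) (x : gprod) : m_act g (z *: x) = z *: m_act g x.
Proof. by apply: ext => i; exact: gactZ. Qed.
Let m_act_mul (g : G) (x y : gprod) :
  m_act g (m_mul x y) = m_mul (m_act g x) (m_act g y).
Proof. by apply: ext => i; exact: gact_amul. Qed.
Let m_act_star (g : G) (x : gprod) : m_act g (m_star x) = m_star (m_act g x).
Proof. by apply: ext => i; exact: gact_astar. Qed.

HB.instance Definition _ := isGStarAlg.Build R G gprod
  m_actD m_actZ m_act_mul m_act_star.

Definition gprod_seminorms : set (gprod -> R) :=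
  [set q | exists i, exists2 p, cseminorms (A i) p & q = fun x => p (x i)].

Let m_cstar q : gprod_seminorms q -> cstar_seminorm q.
Proof.
case=> i [p [hp _ _] ->]; split=> /=.
- by move=> x y; exact: (cstar_triangle hp).
- by move=> z x; exact: (cstar_homog hp).
- by move=> x y; exact: (cstar_submul hp).
- by move=> x; exact: (cstar_isom hp).
- by move=> x; exact: (cstar_id hp).
Qed.

Let m_inv q : gprod_seminorms q -> ginvariant q.
Proof. by case=> i [p [_ ip _] ->] g x; exact: ip. Qed.

Let m_orbit q : gprod_seminorms q ->
  forall (x : gprod) (g0 : G) (e : R), 0 < e ->
  \forall g \near g0, q (gact g x - gact g0 x) < e.
Proof.
case=> i [p hp ->] x g0 e e0.
exact: (cseminorms_orbit hp (x i) g0 e0).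
Qed.

HB.instance Definition _ := GStarAlg_isLmc.Build R G gprod
  m_cstar m_inv m_orbit.

End Product.

(* The product of the empty family *)
Definition gzero (R : realType) (G : topGroupType) : lmcGCstarType R G :=
  gprod (fun i : void => match i with end).

(* p is automatically G-invariant, *-automorphisms of a C*-algebra being
   isometric. *)
Definition is_GCstar {R : realType} {G : topGroupType}
    (A : lmcGCstarType R G) : Prop :=
  exists p : A -> R,
    [/\ cstar_seminorm p, forall a, p a = 0 -> a = 0,
        induces_topology [set p] &
        forall u : nat -> A, pcauchy p u ->
          exists l : A, u n @[n --> \oo] --> l].

Section NuComplete.
Context {d : Order.disp_t} (nu : orderType d).

(* Cardinals are initial ordinals: well-orders that do not inject into any of
   their proper initial segments. *)
Definition is_cardinal : Prop :=
  well_founded (fun x y : nu => (x < y)%O) /\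
  forall x : nu, ~ ([set: nu] #<= [set y : nu | (y < x)%O])%card.

Definition initial_segment (K : set nu) : Prop :=
  forall x y, K y -> (x <= y)%O -> K x.

Definition transfinite_cauchy {A : topologicalZmodType} {K : set nu}
    (x : K -> A) : Prop :=
  forall U : set A, nbhs 0 U -> exists i0 : K, forall i j : K,
    (val i0 <= val i)%O -> (val i0 <= val j)%O -> U (x i - x j).

Definition transfinite_cvg {A : topologicalType} {K : set nu}
    (x : K -> A) (a : A) : Prop :=
  forall U : set A, nbhs a U -> exists i0 : K, forall i : K,
    (val i0 <= val i)%O -> U (x i).

(* The ordinals below or equal to nu are the initial segments of nu. *)
Definition nu_complete {R : realType} {G : topGroupType}
    (A : lmcGCstarType R G) : Prop :=
  hausdorff_space A /\
  forall (K : set nu) (x : K -> A), initial_segment K ->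
    transfinite_cauchy x -> exists a, transfinite_cvg x a.

End NuComplete.

Record is_ghom {R : realType} {G : topGroupType} {A B : lmcGCstarType R G}
    (f : A -> B) : Prop := {
  ghom_linear : forall (z : R[i]) a b, f (z *: a + b) = z *: f a + f b;
  ghom_mul : forall a b, f (amul a b) = amul (f a) (f b);
  ghom_star : forall a, f (astar a) = astar (f a);
  ghom_act : forall (g : G) a, f (gact g a) = gact g (f a);
  ghom_continuous : continuous f
}.

Section Representations.
Context {R : realType} {G : topGroupType} {S : gSetType G}.

(* rel A rho: the elements rho s of A satisfy the relations, which are given by
   their semantics only. Only the values of rel at nu-complete algebras matter:
   every G-C*-algebra is nu-complete. *)
Definition relations := forall A : lmcGCstarType R G, (S -> A) -> Prop.

Definition is_grep (rel : relations) (A : lmcGCstarType R G) (rho : S -> A) :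
    Prop :=
  [/\ forall (g : G) s, rho (gact g s) = gact g (rho s),
      forall s, continuous (fun g : G => gact g (rho s)) & rel A rho].

Record weakly_admissible {d : Order.disp_t} (nu : orderType d)
    (rel : relations) : Prop := {
  wa_zero : is_grep rel (fun _ => 0 : gzero R G);
  wa_sub : forall (A : lmcGCstarType R G) (rho : S -> A) (B : gSubalg A)
      (hB : forall s, gsub_set B (rho s)),
    nu_complete nu A -> nu_complete nu (subalg B) -> is_grep rel rho ->
    is_grep rel (fun s => subalg_in (hB s));
  wa_hom : forall (A B : lmcGCstarType R G) (rho : S -> A) (phi : A -> B),
    nu_complete nu A -> is_GCstar B -> is_ghom phi -> is_grep rel rho ->
    is_grep rel (phi \o rho);
  wa_local : forall (A : lmcGCstarType R G) (rho : S -> A),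
    nu_complete nu A ->
    (forall p (hp : cseminorms A p),
      is_grep rel (fun s => to_completion hp (rho s))) ->
    is_grep rel rho;
  wa_sum : forall n (A : 'I_n.+1 -> lmcGCstarType R G)
      (rho : forall i, S -> A i),
    (forall i, is_GCstar (A i)) -> (forall i, is_grep rel (rho i)) ->
    is_grep rel ((fun s i => rho i s) : S -> gprod A)
}.

End Representations.
Arguments relations R {G} S.

(* Main.v *)
Require Import Defs.
From mathcomp Require Import all_boot all_order all_algebra.
From mathcomp Require Import finmap complex.
From mathcomp Require Import all_classical all_reals.
From mathcomp Require Import topology normedtype.
From mathcomp Require Import lra.

Set Implicit Arguments.
Unset Strict Implicit.
Unset Printing Implicit Defensive.

Import Order.TTheory GRing.Theory Num.Theory.
Import numFieldNormedType.Exports.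

Local Open Scope classical_set_scope.
Local Open Scope ring_scope.

(** Homomorphisms from the universal algebra are continuous and realize every
    G-representation, so a small noncommutative *-polynomial in its generators
    must be small in every G-representation. The coarsest topology with this
    property is the one given by the G-representations on single
    G-C*-algebras, that is, the topology of a subalgebra of a product. All
    G-representations together are too many for a product, but the topology
    only sees the seminorm [t |-> |term_eval sigma t|] that a G-representation
    [sigma] induces on formal polynomials, and these seminorms form a set.
    Choosing one G-representation for each of them gives [big_map] into the
    product [big_alg]; [univ_alg] is the smallest subset of [big_alg] that
    contains the polynomials in the image of [big_map] and is closed under
    limits of nu-sequences. It is a *-subalgebra ([nu_span]), and it is
    nu-complete because products and sequentially closed subalgebras inherit
    nu-completeness and G-C*-algebras have it.

    Homomorphisms are produced by one lemma, [span_extension]. Let [alpha] and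
    [beta] map [S] to [A] and to a nu-complete [B] in such a way that the value
    of a polynomial at [beta] is small as soon as its value at [alpha] is. The
    nu-span of the couples [(alpha s, beta s)] in [A * B] satisfies the same
    estimate, a closed condition; hence it is the graph of a function,
    continuous for the same reason and multiplicative because the graph is an
    algebra. The function is defined on the whole nu-span of [alpha]: a
    nu-sequence that converges in [A] has, by the estimate, Cauchy values
    in [B].

    Given a G-representation [sigma] in [B] and [p] a continuous invariant
    C*-seminorm of [B], [sigma] composed with the map to the completion [B_p]
    is a G-representation in a G-C*-algebra ([completion_GCstar]), so its
    seminorm on polynomials is that of a factor of [big_alg]; this is the
    estimate that [span_extension] needs, and [univ_alg_extension] follows.
    Uniqueness is an induction on the nu-span ([span_ghom_unique]).

    It remains that [univ_map] satisfies the relations. By admissibility it is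
    enough to look at a single completion [C_p]. A continuous seminorm [p] on
    a subalgebra of a product is controlled by finitely many factors
    ([subprod_dominated]), and the relations hold in their direct sum, hence in
    the nu-span of the image of [S] there; [span_extension] maps this
    nu-complete subalgebra to [C_p], and homomorphisms to G-C*-algebras
    preserve the relations. *)

(** * The topology of a family of C*-seminorms *)

Section SeminormTopology.
Context {R : realType} {G : topGroupType}.
Implicit Type A : lmcGCstarType R G.

Lemma induced_cvg A (P : set (A -> R)) T (F : set_system T) (f : T -> A)
    (l : A) :
  induces_topology P -> Filter F ->
  (forall p, P p -> forall e, 0 < e -> \forall x \near F, p (f x - l) < e) ->
  f x @[x --> F] --> l.
Proof.
move=> tP FF h U; rewrite (tP l) => -[H [e [/finite_fsetP[X HX] HP e0 HU]]].
have := @filter_bigI _ _ X (fun p => [set x | p (f x - l) < e]) F FF.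
have hX p : p \in X -> P p by move=> pX; apply: HP; rewrite HX.
move=> /(_ (fun p pX => h p (hX p pX) e e0)) hF.
apply: (@filterS _ F FF _ (f @^-1` U) _ hF) => x hx.
by apply: HU => p; rewrite HX => /hx.
Qed.

(** Continuity alone is asked, and not invariance, so that the norm of a
    G-C*-algebra qualifies directly. *)
Lemma near_seminorm A (p : A -> R) (a : A) (e : R) :
  cstar_seminorm p -> continuous p -> 0 < e -> \forall x \near a, p (x - a) < e.
Proof.
move=> hp cp e0.
have h : (fun x : A => x - a) @ a --> (0 : A).
  rewrite -(subrr a).
  apply: (@continuous_comp A (A * A)%type A (fun x => (x, a))
    (fun x => x.1 - x.2)).
    by apply: cvg_pair; [exact: cvg_id|exact: cvg_cst].
  exact: sub_continuous.
have hp0 : (fun x : A => p (x - a)) @ a --> (0 : R).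
  by rewrite -(cstar0 hp); exact: (continuous_cvg _ (cp 0) h).
by move/cvgrPdist_lt : hp0 => /(_ e e0); apply: filterS => x /=;
  rewrite sub0r normrN ger0_norm ?(cstar_ge0 hp).
Qed.

Lemma induced_continuous A (P : set (A -> R)) (p : A -> R) :
  induces_topology P -> P p -> cstar_seminorm p -> continuous p.
Proof.
move=> tP Pp hp a.
apply/cvgrPdist_lt => e e0.
have : nbhs a [set x | p (x - a) < e].
  rewrite (tP a); exists [set p], e; split=> //; first by move=> _ ->.
  by move=> x; apply.
apply: filterS => x; apply: le_lt_trans.
by rewrite cstarB//; exact: cstar_dist.
Qed.

Lemma induced_cseminorm A (P : set (A -> R)) :
  (forall p, P p -> cstar_seminorm p /\ ginvariant p) -> induces_topology P ->
  P `<=` cseminorms A.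
Proof.
move=> hP tP p Pp; have [hp ip] := hP p Pp; split=> //.
exact: induced_continuous tP Pp hp.
Qed.

Lemma near_cseminorm A (p : A -> R) (a : A) (e : R) :
  cseminorms A p -> 0 < e -> \forall x \near a, p (x - a) < e.
Proof. by case=> hp _ cp; exact: near_seminorm. Qed.

Lemma cseminorms_induce A : induces_topology (cseminorms A).
Proof.
have [P [hP tP]] := @lmc_subproof R G A; move=> a; apply/seteqP; split.
  rewrite (tP a) => U [F [e [fF FP e0 FU]]]; exists F, e; split=> //.
  exact: subset_trans (induced_cseminorm hP tP).
move=> U [F [e [/finite_fsetP[X FX] FP e0 FU]]].
have := @filter_bigI _ _ X (fun p => [set x | p (x - a) < e]) (nbhs a)
  (nbhs_filter a).
have hX p : p \in X -> cseminorms A p by move=> pX; apply: FP; rewrite FX.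
move=> /(_ (fun p pX => near_cseminorm a (hX p pX) e0)) hF.
by apply: (@filterS _ _ (nbhs_filter a) _ _ _ hF) => x hx;
  apply: FU => p; rewrite FX => /hx.
Qed.

Lemma cvg_cseminorms A T (F : set_system T) (f : T -> A) (l : A) (p : A -> R)
    (e : R) : Filter F -> f x @[x --> F] --> l ->
  cseminorms A p -> 0 < e -> \forall x \near F, p (f x - l) < e.
Proof. by move=> FF fl hp e0; exact: (fl _ (near_cseminorm l hp e0)). Qed.

Lemma hausdorff_separates A (P : set (A -> R)) (a : A) :
  induces_topology P -> hausdorff_space A -> (forall p, P p -> p a = 0) ->
  a = 0.
Proof.
move=> tP hA h; apply/esym/hA => U V.
rewrite (tP 0) => -[F [e [_ FP e0 FU]]] Va.
exists a; split; last exact: nbhs_singleton.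
by apply: FU => p /FP hp; rewrite subr0 h.
Qed.

Lemma separates_hausdorff A (P : set (A -> R)) :
  (forall p, P p -> cstar_seminorm p /\ continuous p) ->
  (forall a : A, (forall p, P p -> p a = 0) -> a = 0) -> hausdorff_space A.
Proof.
move=> PA h x y xy; apply/subr0_eq/h => p /PA[sp cp].
apply/eqP; rewrite eq_le (cstar_ge0 sp) andbT leNgt; apply/negP => e0.
have e2 : 0 < p (x - y) / 2 by rewrite divr_gt0.
have [z [/= zx zy]] := xy _ _ (near_seminorm x sp cp e2)
  (near_seminorm y sp cp e2).
suff : p (x - y) < p (x - y) by rewrite ltxx.
apply: le_lt_trans (cstar_tri sp z _ _) _.
by rewrite [ltRHS]splitr ltrD// (cstarB sp).
Qed.

(** In the next three lemmas the neighbourhoods are by construction those of the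
    family of seminorms, so that both sides are convertible. *)
Lemma gprod_topology (I : Type) (A : I -> lmcGCstarType R G) :
  induces_topology (@gprod_seminorms R G I A).
Proof. by []. Qed.

Lemma subalg_topology A (B : gSubalg A) :
  induces_topology (@subalg_seminorms R G A B).
Proof. by []. Qed.

Lemma completion_topology A (p : A -> R) (hp : cseminorms A p) :
  induces_topology [set @cnorm R G A p hp].
Proof. by []. Qed.

End SeminormTopology.
Arguments completion_topology {R G A p} hp a.

(** * Limits of nu-sequences *)

Lemma continuous_slicel (T U V : topologicalType) (f : T * U -> V) (b : U) :
  continuous f -> continuous (fun a => f (a, b)).
Proof.
move=> cf a; apply: (@continuous_comp _ _ _ (fun a => (a, b)) f);
  last exact: cf.
have : (fun a : T => (a, b)) @ a --> (a, b); last exact.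
by apply: cvg_pair; [exact: cvg_id|exact: cvg_cst].
Qed.

Lemma continuous_slicer (T U V : topologicalType) (f : T * U -> V) (a : T) :
  continuous f -> continuous (fun b => f (a, b)).
Proof.
move=> cf b; apply: (@continuous_comp _ _ _ (fun b => (a, b)) f);
  last exact: cf.
have : (fun b : U => (a, b)) @ b --> (a, b); last exact.
by apply: cvg_pair; [exact: cvg_cst|exact: cvg_id].
Qed.

Section Tails.
Context {d : Order.disp_t} {nu : orderType d}.

(** With this filter the convergence of a nu-sequence is convergence of a
    filter, and the seminorm criteria above apply to it. *)
Definition tails (K : set nu) : set_system K :=
  [set V | exists i0 : K, forall i : K, (val i0 <= val i)%O -> V i].
Arguments tails : clear implicits.

Lemma tails_filter (K : set nu) (k : K) : ProperFilter (tails K).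
Proof.
split; first by case=> i0 /(_ i0 (lexx _)).
split; first by exists k.
  move=> U V [i hi] [j hj]; have [ij|/ltW ji] := leP (val i) (val j).
    by exists j => l jl; split; [apply/hi/(le_trans ij)|exact: hj].
  by exists i => l il; split; [exact: hi|apply/hj/(le_trans ji)].
by move=> U V UV [i hi]; exists i => j /hi /UV.
Qed.

Lemma transfinite_cvgE (T : topologicalType) (K : set nu) (x : K -> T) (a : T) :
  transfinite_cvg x a = (x k @[k --> tails K] --> a).
Proof. by []. Qed.

Lemma transfinite_cvg_inhabited (T : topologicalType) (K : set nu) (x : K -> T)
    (a : T) : transfinite_cvg x a -> K.
Proof. by move=> /(_ setT filterT) /cid[k _]; exact: k. Qed.

Lemma transfinite_cvg_comp (T U : topologicalType) (f : T -> U) (K : set nu)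
    (x : K -> T) (a : T) :
  {for a, continuous f} -> transfinite_cvg x a ->
  transfinite_cvg (f \o x) (f a).
Proof. by move=> cf xa V /cf /xa. Qed.

Lemma transfinite_cvg_unique (T : topologicalType) (K : set nu) (x : K -> T)
    (a b : T) : hausdorff_space T ->
  transfinite_cvg x a -> transfinite_cvg x b -> a = b.
Proof.
move=> hT xa xb; have FF := tails_filter (transfinite_cvg_inhabited xa).
exact: (@cvg_unique _ hT (x @ tails K) (fmap_proper_filter x FF) a b xa xb).
Qed.

(** One step of adding limits of nu-sequences need not give a closed set; the
    inductive definition iterates transfinitely, and its induction principle
    says that the result is the smallest sequentially closed set. *)
Inductive nu_closure (T : topologicalType) (E : set T) : set T :=
| nu_closure_sub a : E a -> nu_closure E a
| nu_closure_lim (K : set nu) (x : K -> T) a : initial_segment K ->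
    (forall k, nu_closure E (x k)) -> transfinite_cvg x a -> nu_closure E a.

Lemma nu_closure_map (T U : topologicalType) (f : T -> U) (E : set T)
    (F : set U) : continuous f -> (forall a, E a -> nu_closure F (f a)) ->
  forall a, nu_closure E a -> nu_closure F (f a).
Proof.
move=> cf h a; elim=> {a}[a /h//|K x a hK _ IH xa].
by apply: (nu_closure_lim hK IH); exact: (transfinite_cvg_comp (cf a) xa).
Qed.

(** Separate continuity suffices: for [a] in [E] the argument [b] can run
    through the closure, and then so can [a]. This makes the closure of a
    subalgebra a subalgebra. *)
Lemma nu_closure_map2 (T U V : topologicalType) (f : T -> U -> V) (E : set T)
    (F : set U) (H : set V) :
  (forall b, continuous (f^~ b)) -> (forall a, continuous (f a)) ->
  (forall a b, E a -> F b -> nu_closure H (f a b)) ->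
  forall a b, nu_closure E a -> nu_closure F b -> nu_closure H (f a b).
Proof.
move=> c1 c2 h a b Ea Fb; apply: (nu_closure_map (c1 b) _ Ea) => {Ea}a Ea.
by apply: (nu_closure_map (c2 a) _ Fb) => {Fb}b; exact: h.
Qed.

Lemma nu_closure_closed (T : topologicalType) (E F : set T) :
  closed F -> E `<=` F -> nu_closure E `<=` F.
Proof.
move=> cF EF a; elim=> {a}[a /EF//|K x a hK _ IH xa].
by apply: cF => U /xa[i hi]; exists (x i); split=> //; exact: hi.
Qed.
End Tails.
Arguments tails {d nu} K.

(** * nu-completeness *)

Section Complete.
Context {R : realType} {G : topGroupType} {d : Order.disp_t} {nu : orderType d}.
Implicit Type A : lmcGCstarType R G.

(** The norm has a countable base of balls: picking in a Cauchy nu-sequence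
    points beyond which its diameter is below 1/(n+1) gives an ordinary Cauchy
    sequence, whose limit is the limit of the whole nu-sequence. *)
Lemma GCstar_nu_complete A : is_GCstar A -> nu_complete nu A.
Proof.
case=> N [sN N0 tN cN]; have cN' := induced_continuous tN erefl sN.
split.
  by apply: (@separates_hausdorff _ _ A [set N]) => [p ->|a /(_ N erefl) /N0].
move=> K x hK xC.
have h n : exists i0 : K, forall i j : K, (val i0 <= val i)%O ->
    (val i0 <= val j)%O -> N (x i - x j) < n.+1%:R^-1.
  have [|i0 hi0] := xC [set a | N (a - 0) < n.+1%:R^-1].
    by apply: (near_seminorm _ sN cN'); rewrite invr_gt0.
  by exists i0 => i j /hi0 /[apply] /=; rewrite subr0.
have [i hi] := choice h.
(* The running maximum of i, so that j n lies beyond i m for all m <= n. *)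
pose fix j n := if n is m.+1 then
  if (val (j m) <= val (i n))%O then i n else j m else i 0%N.
have jS n : (val (j n) <= val (j n.+1))%O by rewrite /=; case: ifP.
have ij n : (val (i n) <= val (j n))%O.
  case: n => [|n] /=; first exact: lexx.
  by case: ifPn => [_|]; [exact: lexx|rewrite -ltNge => /ltW].
have jm m n : (m <= n)%N -> (val (i m) <= val (j n))%O.
  elim: n => [|n IH]; first by rewrite leqn0 => /eqP->; exact: ij.
  rewrite leq_eqVlt ltnS => /orP[/eqP->|/IH mn]; first exact: ij.
  exact: le_trans mn (jS n).
have small e : 0 < e -> exists k, k.+1%:R^-1 < e :> R.
  move=> e0; have [k hk] := ltr_add_invr e0.
  by exists k; rewrite add0r in hk.
have /cN[l ul] : pcauchy N (x \o j).
  move=> e /small[k hk]; exists k => m n km kn.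
  by apply: lt_trans hk; apply: hi; exact: jm.
exists l; rewrite transfinite_cvgE; apply: (induced_cvg tN).
  exact: (tails_filter (i 0%N)).
move=> p -> e e0; have e2 : 0 < e / 2 by rewrite divr_gt0.
have [k hk] := small _ e2; exists (i k) => m km.
have [n _ hn] := ul _ (near_seminorm l sN cN' e2).
have /= hl := hn (maxn n k) (leq_maxl _ _).
apply: le_lt_trans (cstar_tri sN (x (j (maxn n k))) _ _) _.
rewrite (splitr e) ltrD//; first apply: lt_trans hk.
by apply: hi => //; apply: jm; exact: leq_maxr.
Qed.

Lemma gprod_cseminorm (I : Type) (A : I -> lmcGCstarType R G) i p :
  cseminorms (A i) p -> cseminorms (gprod A) (fun x => p (x i)).
Proof.
move=> hp; apply: (induced_cseminorm _ (@gprod_topology R G I A)).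
  move=> q [j [{hp}p hp ->]]; case: (hp) => sp ip _.
  split; last by move=> g x; exact: ip.
  split=> [x y|z x|x y|x|x]; [exact: (cstar_triangle sp)|
    exact: (cstar_homog sp)|exact: (cstar_submul sp)|
    exact: (cstar_isom sp)|exact: (cstar_id sp)].
by exists i, p.
Qed.

Lemma gprod_proj_continuous (I : Type) (A : I -> lmcGCstarType R G) i :
  continuous (fun x : gprod A => x i).
Proof.
move=> x; apply: (induced_cvg (@cseminorms_induce _ _ (A i)) (nbhs_filter x)).
move=> p hp e e0.
exact: (near_cseminorm x (gprod_cseminorm hp) e0).
Qed.

Lemma gprod_cvg (I : Type) (A : I -> lmcGCstarType R G) T (F : set_system T)
    (f : T -> gprod A) (l : gprod A) : Filter F ->
  (forall i, f t i @[t --> F] --> l i) -> f t @[t --> F] --> l.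
Proof.
move=> FF h; apply: (induced_cvg (@gprod_topology R G I A)).
by move=> _ [i [p hp ->]] e e0; exact: (cvg_cseminorms _ (h i) hp e0).
Qed.

Lemma gprod_nu_complete (I : Type) (A : I -> lmcGCstarType R G) :
  (forall i, nu_complete nu (A i)) -> nu_complete nu (gprod A).
Proof.
move=> hA; split.
  apply: (@separates_hausdorff _ _ _ (cseminorms (gprod A))).
    by move=> p [].
  move=> a h; apply: functional_extensionality_dep => i.
  apply: (hausdorff_separates (@cseminorms_induce _ _ (A i)) (hA i).1) => p hp.
  exact: (h _ (gprod_cseminorm hp)).
move=> K x hK xC.
have k : K by have [k _] := cid (xC setT filterT).
have xi i : exists a, transfinite_cvg (fun k => x k i) a.
  apply: (hA i).2 => // U U0.
  by have [i0 h] := xC _ (@gprod_proj_continuous _ A i 0 U U0); exists i0.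
exists (fun i => sval (cid (xi i))).
rewrite transfinite_cvgE; apply: gprod_cvg => [|i].
  exact: (tails_filter k).
exact: (svalP (cid (xi i))).
Qed.

Lemma subalg_cseminorm A (B : gSubalg A) p :
  cseminorms A p -> cseminorms (subalg B) (p \o @subalg_val _ _ _ B).
Proof.
move=> hp; apply: (induced_cseminorm _ (@subalg_topology R G A B)).
  move=> q [{hp}p hp ->]; case: (hp) => sp ip _.
  split; last by move=> g x; exact: ip.
  split=> [x y|z x|x y|x|x]; [exact: (cstar_triangle sp)|
    exact: (cstar_homog sp)|exact: (cstar_submul sp)|
    exact: (cstar_isom sp)|exact: (cstar_id sp)].
by exists p.
Qed.

Lemma subalg_valB A (B : gSubalg A) (x y : subalg B) :
  subalg_val (x - y) = subalg_val x - subalg_val y.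
Proof. by rewrite -[- subalg_val y]scaleN1r. Qed.

Lemma subalg_val_inj A (B : gSubalg A) : injective (@subalg_val _ _ _ B).
Proof. exact: val_inj. Qed.

Lemma subalg_cvg A (B : gSubalg A) T (F : set_system T) (f : T -> subalg B)
    (l : subalg B) : Filter F ->
  subalg_val (f t) @[t --> F] --> subalg_val l -> f t @[t --> F] --> l.
Proof.
move=> FF h; apply: (induced_cvg (@subalg_topology R G A B)).
move=> _ [p hp ->] e e0.
under eq_near do rewrite /= subalg_valB.
exact: (cvg_cseminorms _ h hp e0).
Qed.

Lemma subalg_val_continuous A (B : gSubalg A) :
  continuous (@subalg_val _ _ _ B).
Proof.
move=> x; apply: (induced_cvg (@cseminorms_induce _ _ A) (nbhs_filter x)).
move=> p hp e e0.
have := near_cseminorm x (subalg_cseminorm B hp) e0.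
by apply: filterS => y /=; rewrite subalg_valB.
Qed.

Lemma subalg_nu_complete A (B : gSubalg A) : nu_complete nu A ->
  (forall a, nu_closure (nu := nu) B a -> gsub_set B a) ->
  nu_complete nu (subalg B).
Proof.
move=> [hA cA] clB; split.
  apply: (@separates_hausdorff _ _ _ (cseminorms (subalg B))).
    by move=> p [].
  move=> a h; apply: subalg_val_inj.
  apply: (hausdorff_separates (@cseminorms_induce _ _ A) hA) => p hp.
  exact: (h _ (subalg_cseminorm B hp)).
move=> K x hK xC.
have k : K by have [k _] := cid (xC setT filterT).
have [|a xa] := cA K (@subalg_val _ _ _ B \o x) hK.
  move=> U U0; have [i0 h] := xC _ (@subalg_val_continuous _ B 0 U U0).
  by exists i0 => i j ii ij; rewrite /= -subalg_valB; exact: h.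
have Ba : gsub_set B a.
  apply/clB/(nu_closure_lim hK _ xa) => i; apply: nu_closure_sub.
  exact: set_valP.
exists (subalg_in Ba); rewrite transfinite_cvgE; apply: subalg_cvg.
  exact: (tails_filter k).
exact: xa.
Qed.
End Complete.

(** * The completion at a seminorm is a G-C*-algebra *)

Section CompletionGCstar.
Context {R : realType} {G : topGroupType} {A : lmcGCstarType R G} {p : A -> R}.
Variable hp : cseminorms A p.

Local Notation pi u := (\pi_(completion hp) u)%qT.
Local Notation N := (@cnorm R G A p hp).

Let sp : cstar_seminorm p. Proof. by case: hp. Qed.

Lemma piD (u v : cauchy_seq) : pi u + pi v = pi (seq_add hp u v).
Proof. exact: c_addE. Qed.

Lemma piZ (z : R[i]) (u : cauchy_seq) : z *: pi u = pi (seq_scale hp z u).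
Proof. exact: c_scaleE. Qed.

Lemma piM (u v : cauchy_seq) : amul (pi u) (pi v) = pi (seq_mul hp u v).
Proof. exact: c_mulE. Qed.

Lemma pi_star (u : cauchy_seq) : astar (pi u) = pi (seq_star hp u).
Proof. exact: c_starE. Qed.

Lemma pi_act (g : G) (u : cauchy_seq) : gact g (pi u) = pi (seq_act hp g u).
Proof. exact: c_actE. Qed.

Lemma cvg_cnormB (u v : cauchy_seq) :
  p (u n - v n) @[n --> \oo] --> N (pi u - pi v).
Proof.
rewrite -[- pi v]scaleN1r piZ piD.
have := @cvg_cnorm _ _ _ _ hp (seq_add hp u (seq_scale hp (-1) v)).
by under eq_fun do rewrite /= scaleN1r.
Qed.

Arguments cvg_cnormB : clear implicits.

Lemma cnorm_cstB (a b : A) :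
  N (to_completion hp a - to_completion hp b) = p (a - b).
Proof.
rewrite -(cnorm_cst hp); congr N.
rewrite -[- to_completion hp b]scaleN1r /to_completion piZ piD.
by congr (\pi_(completion hp) _)%qT; apply: cauchy_seq_ext => n /=;
  rewrite scaleN1r.
Qed.

Lemma cnorm_cstar : cstar_seminorm N.
Proof.
split.
- move=> x y; have [u ->] := completionW x; have [v ->] := completionW y.
  rewrite piD; apply: ler_cvg_to (@cvg_cnorm _ _ _ _ hp _)
    (cvgD (@cvg_cnorm _ _ _ _ hp u) (@cvg_cnorm _ _ _ _ hp v)) _.
  by apply: nearW => n; exact: (cstar_triangle sp).
- move=> z x; have [u ->] := completionW x; rewrite piZ; apply: cnormE => /=.
  by under eq_fun do rewrite (cstar_homog sp); apply: cvgMr;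
    exact: (@cvg_cnorm _ _ _ _ hp u).
- move=> x y; have [u ->] := completionW x; have [v ->] := completionW y.
  rewrite piM; apply: ler_cvg_to (@cvg_cnorm _ _ _ _ hp _)
    (cvgM (@cvg_cnorm _ _ _ _ hp u) (@cvg_cnorm _ _ _ _ hp v)) _.
  by apply: nearW => n; exact: (cstar_submul sp).
- move=> x; have [u ->] := completionW x; rewrite pi_star; apply: cnormE => /=.
  by under eq_fun do rewrite (cstar_isom sp); exact: (@cvg_cnorm _ _ _ _ hp u).
- move=> x; have [u ->] := completionW x; rewrite pi_star piM.
  apply: cnormE => /=; under eq_fun do rewrite (cstar_id sp) expr2.
  by rewrite expr2; apply: cvgM; exact: (@cvg_cnorm _ _ _ _ hp u).
Qed.

Lemma cnorm_eq0 x : N x = 0 -> x = 0.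
Proof.
have [u ->] := completionW x => Nu; apply/pi_eqP/asboolP => e e0.
have := @cvg_cnorm _ _ _ _ hp u; rewrite Nu => /cvgrPdist_lt /(_ e e0)[n _ hn].
exists n => m nm; rewrite /= subr0; apply: le_lt_trans (hn m nm).
by rewrite sub0r normrN ler_norm.
Qed.

Lemma to_completion_ghom : is_ghom (to_completion hp).
Proof.
split.
- move=> z a b; rewrite /to_completion piZ piD.
  by congr (\pi_(completion hp) _)%qT; apply: cauchy_seq_ext.
- move=> a b; rewrite /to_completion piM.
  by congr (\pi_(completion hp) _)%qT; apply: cauchy_seq_ext.
- move=> a; rewrite /to_completion pi_star.
  by congr (\pi_(completion hp) _)%qT; apply: cauchy_seq_ext.
- move=> g a; rewrite /to_completion pi_act.
  by congr (\pi_(completion hp) _)%qT; apply: cauchy_seq_ext.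
- move=> a; apply: (@induced_cvg _ _ (completion hp) _ _ _ (to_completion hp) _
    (completion_topology hp) (nbhs_filter a)).
  move=> _ -> e e0; apply: (@filterS _ _ (nbhs_filter a) _ _ _
    (near_cseminorm a hp e0)) => x.
  by rewrite cnorm_cstB.
Qed.

Lemma to_completion_dense (x : completion hp) (e : R) : 0 < e ->
  exists a, N (x - to_completion hp a) < e.
Proof.
have [u ->] := completionW x => e0.
have e2 : 0 < e / 2 by rewrite divr_gt0.
have [n hn] := cseqP u e2; exists (u n).
apply: (@le_lt_trans _ _ (e / 2)); last first.
  by rewrite ltr_pdivrMr// ltr_pMr// ltr1n.
apply: ler_cvg_to (cvg_cnormB u (seq_cst hp (u n))) (cvg_cst (e / 2)) _.
by exists n => // m /= nm; rewrite ltW// hn.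
Qed.

(** Completeness is the diagonal argument: approximate the n-th term up to
    1/(n+1) by the image of an element of [A]; these elements form a Cauchy
    sequence for [p], whose class is the limit. *)
Lemma completion_GCstar : is_GCstar (completion hp).
Proof.
exists N; split; [exact: cnorm_cstar|exact: cnorm_eq0|
  exact: completion_topology|move=> U UC].
have sN := cnorm_cstar.
have inv0 n : 0 < n.+1%:R^-1 :> R by rewrite invr_gt0.
have [a ha] := choice (fun n => to_completion_dense (U n) (inv0 n)).
have ha' e : 0 < e -> exists k, forall n, (k <= n)%N ->
    N (U n - to_completion hp (a n)) < e.
  move=> e0; have [k] := ltr_add_invr e0; rewrite add0r => hk.
  exists k => n kn; apply: lt_trans (ha n) _; apply: le_lt_trans hk.
  by rewrite lef_pV2 ?posrE// ler_nat.
have aC : pcauchy p a.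
  move=> e e0; have e3 : 0 < e / 3 by rewrite divr_gt0.
  have [k hk] := ha' _ e3; have [l hl] := UC _ e3.
  exists (maxn k l) => m n; rewrite !geq_max => /andP[km lm] /andP[kn ln].
  rewrite -cnorm_cstB.
  have -> : e = e / 3 + (e / 3 + e / 3) by lra.
  apply: le_lt_trans (cstar_tri sN (U m) _ _) _; rewrite ltrD//.
    by rewrite (cstarB sN) hk.
  apply: le_lt_trans (cstar_tri sN (U n) _ _) _; rewrite ltrD//.
    exact: hl.
  exact: hk.
exists (pi (CauchySeq aC)).
apply: (induced_cvg (completion_topology hp)) => _ -> e e0.
have e3 : 0 < e / 2 by rewrite divr_gt0.
have [k hk] := ha' _ e3; have [l hl] := aC _ e3.
exists (maxn k l) => // n /=; rewrite geq_max => /andP[kn ln].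
apply: le_lt_trans (cstar_tri sN (to_completion hp (a n)) _ _) _.
rewrite [ltRHS]splitr ltr_leD//; first exact: hk.
apply: ler_cvg_to (cvg_cnormB (seq_cst hp (a n)) (CauchySeq aC))
  (cvg_cst (e / 2)) _.
by exists l => // m /= lm; rewrite ltW// hl.
Qed.
End CompletionGCstar.

(** * Noncommutative *-polynomials and the algebras they span *)

Section Terms.
Context {R : realType} {G : topGroupType} {S : Type}.

(** Raw syntax is enough: terms serve only through their values, so the
    identities of *-algebras need not be imposed. [TAct] makes the set of
    values stable under [G] for an arbitrary map [S -> A], and [TZero] makes it
    nonempty when [S] is empty. *)
Inductive term : Type :=
| TGen of S
| TZero
| TAdd of term & term
| TScale of R[i] & term
| TMul of term & term
| TStar of term
| TAct of G & term.

Fixpoint term_eval (A : lmcGCstarType R G) (alpha : S -> A) (t : term) : A :=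
  match t with
  | TGen s => alpha s
  | TZero => 0
  | TAdd t u => term_eval alpha t + term_eval alpha u
  | TScale z t => z *: term_eval alpha t
  | TMul t u => amul (term_eval alpha t) (term_eval alpha u)
  | TStar t => astar (term_eval alpha t)
  | TAct g t => gact g (term_eval alpha t)
  end.

Section Ghom.
Variables (A B : lmcGCstarType R G) (phi : A -> B).
Hypothesis phi_hom : is_ghom phi.

Lemma ghom0 : phi 0 = 0.
Proof.
have := ghom_linear phi_hom (-1) 0 0.
by rewrite scaler0 addr0 scaleN1r addNr.
Qed.

Lemma ghomD a b : phi (a + b) = phi a + phi b.
Proof. by have := ghom_linear phi_hom 1 a b; rewrite !scale1r. Qed.

Lemma ghomZ z a : phi (z *: a) = z *: phi a.
Proof. by have := ghom_linear phi_hom z a 0; rewrite ghom0 !addr0. Qed.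

Lemma ghom_term_eval (alpha : S -> A) t :
  phi (term_eval alpha t) = term_eval (phi \o alpha) t.
Proof.
elim: t => //= [|t IHt u IHu|z t IH|t IHt u IHu|t IH|g t IH].
- exact: ghom0.
- by rewrite ghomD IHt IHu.
- by rewrite ghomZ IH.
- by rewrite (ghom_mul phi_hom) IHt IHu.
- by rewrite (ghom_star phi_hom) IH.
- by rewrite (ghom_act phi_hom) IH.
Qed.
End Ghom.

Lemma ghom_comp (A B C : lmcGCstarType R G) (f : A -> B) (h : B -> C) :
  is_ghom f -> is_ghom h -> is_ghom (h \o f).
Proof.
move=> hf hh; split=> /= [z a b|a b|a|g a|a].
- by rewrite (ghom_linear hf) (ghom_linear hh).
- by rewrite (ghom_mul hf) (ghom_mul hh).
- by rewrite (ghom_star hf) (ghom_star hh).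
- by rewrite (ghom_act hf) (ghom_act hh).
- by apply: continuous_comp; apply: ghom_continuous.
Qed.

Lemma proj_ghom (I : Type) (A : I -> lmcGCstarType R G) i :
  is_ghom (fun x : gprod A => x i).
Proof. by split=> //; exact: gprod_proj_continuous. Qed.

Lemma subalg_val_ghom (A : lmcGCstarType R G) (B : gSubalg A) :
  is_ghom (@subalg_val _ _ _ B).
Proof. by split=> //; exact: subalg_val_continuous. Qed.

End Terms.
Arguments term : clear implicits.

Section Span.
Context {R : realType} {G : topGroupType} {d : Order.disp_t} (nu : orderType d).
Context {S : Type} {A : lmcGCstarType R G} (alpha : S -> A).

Definition span_set : set A := nu_closure (nu := nu) (range (term_eval alpha)).

Lemma term_eval_span t : span_set (term_eval alpha t).
Proof. by apply: nu_closure_sub; exists t. Qed.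

Lemma spanD a b : span_set a -> span_set b -> span_set (a + b).
Proof.
apply: (nu_closure_map2 (f := fun a b : A => a + b)) => [{}b|{}a|].
- exact: (continuous_slicel (f := fun x : A * A => x.1 + x.2) add_continuous).
- exact: (continuous_slicer (f := fun x : A * A => x.1 + x.2) add_continuous).
- by move=> _ _ [t _ <-] [u _ <-]; exact: (term_eval_span (TAdd t u)).
Qed.

Lemma spanZ z a : span_set a -> span_set (z *: a).
Proof.
apply: nu_closure_map; last first.
  by move=> _ [t _ <-]; exact: (term_eval_span (TScale z t)).
exact: (continuous_slicer (f := fun x : R[i]^o * A => x.1 *: x.2)
  scale_continuous).
Qed.

Lemma spanM a b : span_set a -> span_set b -> span_set (amul a b).
Proof.
apply: (nu_closure_map2 (f := amul)) => [{}b|{}a|_ _ [t _ <-] [u _ <-]].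
- exact: (continuous_slicel amul_continuous).
- exact: (continuous_slicer amul_continuous).
- exact: (term_eval_span (TMul t u)).
Qed.

Lemma span_star a : span_set a -> span_set (astar a).
Proof.
apply: nu_closure_map; first exact: astar_continuous.
by move=> _ [t _ <-]; exact: (term_eval_span (TStar t)).
Qed.

Lemma span_act (g : G) a : span_set a -> span_set (gact g a).
Proof.
apply: nu_closure_map; first exact: gact_continuous.
by move=> _ [t _ <-]; exact: (term_eval_span (TAct g t)).
Qed.

(** The closure is taken under nu-sequences and not in the topology: maps into
    an algebra that is only nu-complete need not extend further. *)
Definition nu_span : gSubalg A :=
  GSubalg (term_eval_span TZero) spanD spanZ spanM span_star span_act.

Definition to_span (s : S) : subalg nu_span :=
  subalg_in (term_eval_span (TGen s) : gsub_set nu_span (alpha s)).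

Lemma spanB a b : span_set a -> span_set b -> span_set (a - b).
Proof. by move=> ha hb; rewrite -scaleN1r; exact: spanD ha (spanZ _ hb). Qed.

Lemma span_nu_complete : nu_complete nu A -> nu_complete nu (subalg nu_span).
Proof.
move=> cA; apply: (subalg_nu_complete cA) => a; elim=> // K x {}a hK _ IH xa.
exact: nu_closure_lim hK IH xa.
Qed.

Lemma term_eval_to_span t :
  subalg_val (term_eval to_span t) = term_eval alpha t.
Proof. by rewrite (ghom_term_eval (subalg_val_ghom _)). Qed.

Lemma span_ghom_unique (B : lmcGCstarType R G) (f h : subalg nu_span -> B) :
  hausdorff_space B -> is_ghom f -> is_ghom h -> f \o to_span = h \o to_span ->
  f = h.
Proof.
move=> hB hf hh fh; apply/funext => -[a Pa].
have : forall b (Pb : gsub_set nu_span b), f (subalg_in Pb) = h (subalg_in Pb).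
  move=> b Pb; move: (Pb : span_set b) (Pb) => {Pb}.
  elim=> {b}[_ [t _ <-] Pb|K x b hK Px IH xb Pb].
    have -> : subalg_in Pb = term_eval to_span t.
      by apply: subalg_val_inj; rewrite term_eval_to_span.
    by rewrite !(@ghom_term_eval _ _ S) // fh.
  (* A limit in A of elements of the span is a limit in the span itself. *)
  have yb : transfinite_cvg (fun k => subalg_in (Px k : gsub_set nu_span (x k)))
      (subalg_in Pb).
    rewrite transfinite_cvgE; apply: subalg_cvg; last exact: xb.
    exact: (tails_filter (transfinite_cvg_inhabited xb)).
  have cf : continuous f := @ghom_continuous _ _ _ _ _ hf.
  have ch : continuous h := @ghom_continuous _ _ _ _ _ hh.
  apply: (transfinite_cvg_unique hB (transfinite_cvg_comp (cf _) yb)).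
  rewrite (_ : f \o _ = h \o
      (fun k => subalg_in (Px k : gsub_set nu_span (x k)))).
    exact: (transfinite_cvg_comp (ch _) yb).
  by apply/funext => k /=; exact: IH.
move=> /(_ a (set_mem Pa)).
by rewrite /subalg_in (Prop_irrelevance (mem_set _) Pa).
Qed.
End Span.

(** * Extending a map of generators to a homomorphism *)

Section Extension.
Context {R : realType} {G : topGroupType} {d : Order.disp_t} (nu : orderType d).
Context {S : Type} {A B : lmcGCstarType R G} (alpha : S -> A) (beta : S -> B).
Variable P : set (B -> R).
Hypothesis hP : forall p, P p -> cstar_seminorm p.
Hypothesis tP : induces_topology P.
Hypothesis cB : nu_complete nu B.
(** Continuity at 0 of the correspondence from the value at [alpha] to the value
    at [beta]; it is not known yet to be a function. *)
Hypothesis dom : forall p e, P p -> 0 < e ->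
  exists2 U : set A, nbhs 0 U &
    forall t, U (term_eval alpha t) -> p (term_eval beta t) < e.

(** The product of [A] and [B], written as a product over [bool] so that it is
    an lmc G-C*-algebra. *)
Let AB (i : bool) : lmcGCstarType R G := if i then A else B.

Let couple (a : A) (b : B) : gprod AB :=
  fun i => if i as i0 return AB i0 then a else b.

Let fst_ (x : gprod AB) : A := x true.
Let snd_ (x : gprod AB) : B := x false.

Let couple_eq (x y : gprod AB) : fst_ x = fst_ y -> snd_ x = snd_ y -> x = y.
Proof. by move=> h1 h2; apply: functional_extensionality_dep => -[]. Qed.

Let fst_continuous : continuous fst_.
Proof. exact: (@gprod_proj_continuous _ _ _ AB true). Qed.

Let snd_continuous : continuous snd_.
Proof. exact: (@gprod_proj_continuous _ _ _ AB false). Qed.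

Let graph : gSubalg (gprod AB) :=
  nu_span nu (fun s => couple (alpha s) (beta s)).

Let graph_eval t :
  gsub_set graph (couple (term_eval alpha t) (term_eval beta t)).
Proof.
rewrite (_ : couple _ _ = term_eval (fun s => couple (alpha s) (beta s)) t).
  exact: term_eval_span.
apply: couple_eq.
  by rewrite /fst_ (ghom_term_eval (@proj_ghom _ _ _ AB true)).
by rewrite /snd_ (ghom_term_eval (@proj_ghom _ _ _ AB false)).
Qed.

(** The estimate passes to limits once it is a closed condition; this is why
    [U] is replaced by its interior and the strict bound by [<= e / 2]. *)
Let graph_dom p e : P p -> 0 < e -> exists2 U : set A, nbhs 0 U &
  forall x, gsub_set graph x -> U (fst_ x) -> p (snd_ x) < e.
Proof.
move=> Pp e0; have e2 : 0 < e / 2 by rewrite divr_gt0.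
have [U U0 hU] := dom Pp e2.
exists U^°; first exact: nbhs_interior.
pose F := (fst_ @^-1` ~` U^°) `|` ((p \o snd_) @^-1` [set r | r <= e / 2]).
have cF : closed F.
  apply: closedU; apply: preimage_closed.
  - by move=> x _; exact: fst_continuous.
  - exact/open_closedC/open_interior.
  - move=> x _; apply: continuous_comp; first exact: snd_continuous.
    exact: (induced_continuous tP Pp (hP Pp)).
  - exact: closed_le.
suff GF : forall x, gsub_set graph x -> F x.
  move=> x /GF[//|/= h _]; apply: le_lt_trans h _.
  by rewrite ltr_pdivrMr// ltr_pMr// ltr1n.
apply: (nu_closure_closed cF) => _ [t _ <-].
have [h|h] := pselect (U^° (term_eval alpha t)); [right|left] => /=.
  rewrite /snd_ (ghom_term_eval (@proj_ghom _ _ _ AB false)).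
  exact: ltW (hU _ (interior_subset h)).
by rewrite /fst_ (ghom_term_eval (@proj_ghom _ _ _ AB true)).
Qed.

Let graphB x y : gsub_set graph x -> gsub_set graph y -> gsub_set graph (x - y).
Proof. exact: spanB. Qed.

Let graph_unique x y : gsub_set graph x -> gsub_set graph y ->
  fst_ x = fst_ y -> snd_ x = snd_ y.
Proof.
move=> gx gy xy; apply/subr0_eq/(hausdorff_separates tP cB.1) => p Pp.
apply/eqP; rewrite eq_le (cstar_ge0 (hP Pp)) andbT leNgt; apply/negP => e0.
have [U U0 hU] := graph_dom Pp e0.
suff : p (snd_ x - snd_ y) < p (snd_ x - snd_ y) by rewrite ltxx.
apply: (hU _ (graphB gx gy)).
rewrite /fst_ (_ : (x - y) true = fst_ x - fst_ y)// xy subrr.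
exact: nbhs_singleton.
Qed.

(** This is where nu-completeness of [B] replaces completeness: the closure is
    built from limits of nu-sequences only, and the estimate turns a convergent
    nu-sequence of first components into a Cauchy one of second components. *)
Let graph_total a : span_set nu alpha a ->
  exists b, gsub_set graph (couple a b).
Proof.
elim=> {a}[_ [t _ <-]|K x a hK _ /choice[y gy] xa].
  by exists (term_eval beta t); exact: graph_eval.
have k := transfinite_cvg_inhabited xa; have FF := tails_filter k.
have xC : x ij.1 - x ij.2 @[ij --> (tails K, tails K)] --> (0 : A).
  rewrite -(subrr a).
  have sc : (z.1 - z.2) @[z --> ((a, a) : (A * A)%type)] --> a - a.
    exact: (@sub_continuous A (a, a)).
  apply: (@cvg_comp _ _ _ (fun ij : K * K => (x ij.1, x ij.2))
    (fun z : A * A => z.1 - z.2) _ (nbhs (a, a))); last exact: sc.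
  apply: cvg_pair.
    exact: cvg_comp cvg_fst xa.
  exact: cvg_comp cvg_snd xa.
have yC : y ij.1 - y ij.2 @[ij --> (tails K, tails K)] --> (0 : B).
  apply: (induced_cvg tP) => p Pp e e0; have [U U0 hU] := graph_dom Pp e0.
  have xU : \forall ij \near (tails K, tails K), U (x ij.1 - x ij.2).
    exact: xC _ U0.
  apply: filterS xU => -[i j] /= Uij; rewrite subr0.
  exact: (hU _ (graphB (gy i) (gy j))).
have [|b yb] := cB.2 K y hK.
  move=> U /yC[[V W] [[i hi] [j hj]] VW].
  have [ij|/ltW ji] := leP (val i) (val j).
    exists j => m n jm jn; apply: (VW (m, n)); split; last exact: hj.
    by apply: hi; exact: le_trans jm.
  exists i => m n im iN; apply: (VW (m, n)); split; first exact: hi.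
  by apply: hj; exact: le_trans iN.
exists b; apply: (nu_closure_lim hK gy).
by rewrite transfinite_cvgE; apply: gprod_cvg => -[].
Qed.

(** The graph is a closed subalgebra, so the function it defines inherits the
    algebraic identities from the operations on couples. *)
Lemma span_extension :
  exists2 phi : subalg (nu_span nu alpha) -> B, is_ghom phi &
    phi \o to_span nu alpha = beta.
Proof.
have tot (x : subalg (nu_span nu alpha)) :
    exists b, gsub_set graph (couple (subalg_val x) b).
  by apply: graph_total; exact: set_valP.
have [phi gphi] := choice tot.
have phiP x w : gsub_set graph w -> fst_ w = subalg_val x -> phi x = snd_ w.
  by move=> gw wx; rewrite (graph_unique gw (gphi x) wx).
exists phi; last first.
  by apply/funext => s; exact: (phiP _ _ (graph_eval (TGen s))).
split.
- by move=> z x y; exact: (phiP _ _ (gsubD (gsubZ z (gphi x)) (gphi y))).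
- by move=> x y; exact: (phiP _ _ (gsubM (gphi x) (gphi y))).
- by move=> x; exact: (phiP _ _ (gsub_star (gphi x))).
- by move=> g x; exact: (phiP _ _ (gsub_act g (gphi x))).
- move=> x; apply: (induced_cvg tP (nbhs_filter x)) => p Pp e e0.
  have [U U0 hU] := graph_dom Pp e0.
  have h : subalg_val y - subalg_val x @[y --> x] --> (0 : A).
    rewrite -(subrr (subalg_val x)).
    apply: (@cvg_comp _ _ _ (fun y => subalg_val y)
      (fun a : A => a - subalg_val x) _ (nbhs (subalg_val x))).
      exact: subalg_val_continuous.
    have cs : continuous (fun a : A => a - subalg_val x).
      exact: (continuous_slicel (f := fun z : A * A => z.1 - z.2)
        (@sub_continuous A)).
    exact: (cs (subalg_val x)).
  apply: (@filterS _ _ (nbhs_filter x) _ _ _ (h _ U0)) => y /= Uyx.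
  exact: (hU _ (graphB (gphi y) (gphi x))).
Qed.
End Extension.

(** * Seminorms on subalgebras of products *)

Section SubalgebrasOfProducts.
Context {R : realType} {G : topGroupType}.

Lemma cseminorm0 (A : lmcGCstarType R G) : cseminorms A (fun=> 0).
Proof.
split=> //; last by move=> a; exact: cvg_cst.
by split=> *; rewrite ?addr0 ?mulr0 ?expr0n.
Qed.

Lemma subalg_nbhs (A : lmcGCstarType R G) (B : gSubalg A) (x : subalg B)
    (V : set (subalg B)) : nbhs x V ->
  exists2 W, nbhs (subalg_val x) W & forall y, W (subalg_val y) -> V y.
Proof.
rewrite subalg_topology => -[F [e [/finite_fsetP[X FX] FP e0 FV]]].
have /choice[c hc] q : exists p, F q ->
    cseminorms A p /\ q = p \o @subalg_val _ _ _ B.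
  have [/FP[p hp ->]|nFq] := pselect (F q).
    by exists p.
  by exists (fun=> 0).
have := @filter_bigI _ _ X (fun q => [set y | c q (y - subalg_val x) < e])
  (nbhs (subalg_val x)) (nbhs_filter _).
have XF q : q \in X -> F q by rewrite FX.
move=> /(_ (fun q qX => near_cseminorm _ (hc q (XF q qX)).1 e0)) nW.
exists (\bigcap_(q in [set` X]) [set y | c q (y - subalg_val x) < e]) => //.
move=> y Wy; apply: FV => q Fq; rewrite (hc q Fq).2 /= subalg_valB.
by apply: Wy; rewrite -FX.
Qed.

(** A neighbourhood of 0 in the unit ball of [p] involves finitely many
    coordinates, and homogeneity gives the bound at every scale. The finite
    family is listed with at least one entry, as direct sums of G-C*-algebras
    are indexed that way; [i0] fills the extra entry. *)
Lemma subprod_dominated (I : Type) (A : I -> lmcGCstarType R G) (i0 : I)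
    (B : gSubalg (gprod A)) (p : subalg B -> R) : cseminorms (subalg B) p ->
  exists n (idx : 'I_n.+1 -> I) (q : forall j, A (idx j) -> R) (delta : R),
    [/\ forall j, cseminorms (A (idx j)) (q j), 0 < delta &
      forall e x, 0 < e ->
        (forall j, q j ((subalg_val x : gprod A) (idx j)) < delta * e) ->
        p x < e].
Proof.
move=> hp; have [sp _ _] := hp.
have [W] := subalg_nbhs (near_cseminorm 0 hp ltr01).
rewrite (gprod_topology _) => -[F [delta [/finite_fsetP[X FX] FP d0 FW]]] WV.
have /choice[c hc] h : exists k : {i & A i -> R},
    cseminorms (A (projT1 k)) (projT2 k) /\
    (F h -> h = fun x => projT2 k (x (projT1 k))).
  have [/FP[i [q hq ->]]|nFh] := pselect (F h).
    by exists (existT _ i q).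
  by exists (existT _ i0 (fun=> 0)); split=> //; exact: cseminorm0.
(* The last index is out of range: its coordinate is whatever c assigns to the
   default value. *)
pose h j := nth (fun=> 0) X j : gprod A -> R.
exists (size X), (fun j => projT1 (c (h j))), (fun j => projT2 (c (h j))),
  delta.
split=> // [j|e x e0 hx]; first exact: (hc _).1.
have ec0 : 0 < e^-1 by rewrite invr_gt0.
have nz : Normc.normc (e^-1)%:C%C = e^-1.
  by rewrite /Normc.normc/= expr0n addr0 sqrtr_sqr ger0_norm// ltW.
(* Rescaling by 1/e brings x into the neighbourhood found at scale 1. *)
have : p ((e^-1)%:C%C *: x - 0) < 1.
  apply: WV; apply: FW => k Fk; rewrite subr0.
  have kX : k \in (X : seq _) by move: Fk; rewrite FX.
  have jX : (index k X < (size X).+1)%N by rewrite ltnS index_size.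
  have := hx (Ordinal jX); rewrite /h /= nth_index// => hk.
  have [sq _ _] := (hc k).1.
  have -> : k (subalg_val ((e^-1)%:C%C *: x)) =
      e^-1 * projT2 (c k) ((subalg_val x : gprod A) (projT1 (c k))).
    by rewrite -[X in X * _]nz -(cstar_homog sq) [in LHS]((hc k).2 Fk).
  by rewrite mulrC ltr_pdivrMr.
by rewrite subr0 (cstar_homog sp) nz mulrC ltr_pdivrMr// mul1r.
Qed.
End SubalgebrasOfProducts.

(** * The universal algebra *)

Section UniversalAlgebra.
Context {R : realType} {G : topGroupType} {S : gSetType G}.
Context {d : Order.disp_t} (nu : orderType d) (rel : relations R S).
Hypothesis rel_wa : weakly_admissible nu rel.

(** The norm is recorded because a G-C*-algebra only asserts that one exists,
    and [term_norm] has to be a function of the representation. *)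
Record cstar_rep := CstarRep {
  rep_alg : lmcGCstarType R G;
  rep_norm : rep_alg -> R;
  rep_map : S -> rep_alg;
  rep_normP : cstar_seminorm rep_norm /\ continuous rep_norm;
  rep_GCstar : is_GCstar rep_alg;
  rep_mapP : is_grep rel rep_map
}.

Definition term_norm (r : cstar_rep) (t : term R G S) : R :=
  rep_norm (term_eval (@rep_map r) t).

(** G-representations on G-C*-algebras up to the seminorm they induce on terms:
    unlike [cstar_rep], a type small enough to index a product. *)
Definition rep_index : Type :=
  {f : term R G S -> R | exists r, f = term_norm r}.

Definition index_rep (i : rep_index) : cstar_rep := sval (cid (svalP i)).

Lemma index_repE i : sval i = term_norm (index_rep i).
Proof. exact: svalP (cid (svalP i)). Qed.

Lemma zero_GCstar : is_GCstar (gzero R G).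
Proof.
exists (fun=> 0); have z0 (x y : gzero R G) : x = y.
  by apply: functional_extensionality_dep => -[].
split=> //.
- by have [] := cseminorm0 (gzero R G).
- move=> a; apply/seteqP; split=> U.
    move=> /nbhs_singleton Ua; exists set0, 1; split=> //.
    by move=> x _; rewrite (z0 x a).
  case=> F [e [_ F0 e0 FU]]; rewrite (_ : U = setT); first exact: filterT.
  apply/seteqP; split=> // x _; apply: FU => p /F0 ->//.
- by move=> u _; exists 0; rewrite (_ : u = fun=> 0);
    [exact: cvg_cst|apply/funext].
Qed.

Let zero_norm : cstar_seminorm ((fun=> 0) : gzero R G -> R) /\
  continuous ((fun=> 0) : gzero R G -> R).
Proof. by have [] := cseminorm0 (gzero R G). Qed.

Definition zero_rep : cstar_rep :=
  CstarRep zero_norm zero_GCstar (wa_zero rel_wa).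

Definition index0 : rep_index := exist _ _ (ex_intro _ zero_rep erefl).

Definition big_alg : lmcGCstarType R G :=
  gprod (fun i => rep_alg (index_rep i)).

Definition big_map (s : S) : big_alg := fun i => rep_map (index_rep i) s.

Definition univ_alg : lmcGCstarType R G := subalg (nu_span nu big_map).

Definition univ_map : S -> univ_alg := to_span nu big_map.

Lemma univ_alg_complete : nu_complete nu univ_alg.
Proof.
apply/span_nu_complete/gprod_nu_complete => i.
exact/GCstar_nu_complete/rep_GCstar.
Qed.

(** The map to the completion factors through the span of the generators in a
    finite direct sum of factors, where the relations hold. *)
Lemma univ_map_completion_grep p (hp : cseminorms univ_alg p) :
  is_grep rel (fun s => to_completion hp (univ_map s)).
Proof.
have [n [idx [q [delta [hq d0 dom]]]]] := subprod_dominated index0 hp.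
pose E := gprod (fun j => rep_alg (index_rep (idx j))).
pose alpha (s : S) : E := fun j => rep_map (index_rep (idx j)) s.
have cE : nu_complete nu E.
  by apply: gprod_nu_complete => j; exact/GCstar_nu_complete/rep_GCstar.
have alphaP : is_grep rel alpha.
  apply: (wa_sum rel_wa) => j; first exact: rep_GCstar.
  exact: rep_mapP.
have spanP : is_grep rel (to_span nu alpha).
  apply: (wa_sub rel_wa) => //; exact: span_nu_complete.
have cC : nu_complete nu (completion hp).
  by apply: GCstar_nu_complete; exact: completion_GCstar.
have [||||phi phi_hom phiE] := @span_extension R G d nu S E (completion hp)
    alpha (fun s => to_completion hp (univ_map s))
    [set @cnorm R G univ_alg p hp].
- by move=> _ ->; exact: cnorm_cstar.
- exact: completion_topology.
- exact: cC.
- move=> _ e -> e0.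
  exists [set y : E | forall j, q j ((y : gprod _) j) < delta * e].
    apply: (@filter_forall _ _
      (fun j => [set y : E | q j ((y : gprod _) j) < delta * e]) (nbhs (0 : E))
      (nbhs_filter _)) => j.
    have := near_cseminorm (0 : E) (gprod_cseminorm
      (A := fun j => rep_alg (index_rep (idx j))) (hq j)) (mulr_gt0 d0 e0).
    by apply: (@filterS _ _ (nbhs_filter (0 : E))) => y; rewrite subr0.
  move=> t ht; rewrite -[X in cnorm X](ghom_term_eval (to_completion_ghom hp)).
  rewrite cnorm_cst; apply: dom => // j; rewrite term_eval_to_span.
  have := ht j; rewrite (ghom_term_eval (proj_ghom _ j)).
  by rewrite (ghom_term_eval (proj_ghom _ (idx j))).
rewrite -phiE; apply: (wa_hom rel_wa) => //.
  exact: span_nu_complete.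
exact: completion_GCstar.
Qed.

Lemma univ_map_grep : is_grep rel univ_map.
Proof.
apply: (wa_local rel_wa univ_alg_complete) => p hp.
exact: univ_map_completion_grep.
Qed.

(** For each seminorm [p] of [B] the representation in [B_p] has the same
    seminorm on terms as one of the factors, although that factor may come from
    a different representation. *)
Lemma univ_alg_extension (B : lmcGCstarType R G) (sigma : S -> B) :
  nu_complete nu B -> is_grep rel sigma ->
  exists2 phi : univ_alg -> B, is_ghom phi & phi \o univ_map = sigma.
Proof.
move=> cB sigmaP.
apply: (span_extension (P := cseminorms B)) => //.
- by move=> p [].
- exact: cseminorms_induce.
move=> p e hp e0.
have locP : is_grep rel (to_completion hp \o sigma).
  apply: (wa_hom rel_wa) => //; first exact: completion_GCstar.
  exact: to_completion_ghom.
have normP : cstar_seminorm (@cnorm R G B p hp) /\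
    continuous (@cnorm R G B p hp).
  have h := cnorm_cstar hp; split=> //.
  exact: (induced_continuous (completion_topology hp) erefl h).
pose r := CstarRep normP (completion_GCstar hp) locP.
pose i : rep_index := exist _ (term_norm r) (ex_intro _ r erefl).
have [si ci] := rep_normP (index_rep i).
exists [set x : big_alg |
  rep_norm ((x : gprod _) i : rep_alg (index_rep i)) < e].
  have := @gprod_proj_continuous _ _ _ (fun i => rep_alg (index_rep i)) i 0 _
    (near_seminorm 0 si ci e0).
  by apply: (@filterS _ _ (nbhs_filter (0 : big_alg))) => x /=; rewrite subr0.
move=> t /=; rewrite (ghom_term_eval (proj_ghom _ i)) => ht.
rewrite -(cnorm_cst hp) (ghom_term_eval (to_completion_ghom hp)).
rewrite [X in X < e](_ : _ = term_norm (index_rep i) t)//.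
by rewrite -index_repE.
Qed.

(** Admissibility asks this only for a target that is a G-C*-algebra; the local
    characterization of the relations reduces to that case. *)
Lemma grep_comp (A B : lmcGCstarType R G) (rho : S -> A) (phi : A -> B) :
  nu_complete nu A -> nu_complete nu B -> is_ghom phi -> is_grep rel rho ->
  is_grep rel (phi \o rho).
Proof.
move=> cA cB phi_hom rhoP; apply: (wa_local rel_wa cB) => p hp.
apply: (wa_hom rel_wa (phi := to_completion hp \o phi)) => //.
  exact: completion_GCstar.
exact: ghom_comp phi_hom (to_completion_ghom hp).
Qed.
End UniversalAlgebra.

Theorem theorem4p3 (R : realType) (G : topGroupType)
    (G_lc : locally_compact [set: G]) (G_sc : @second_countable G)
    (d : Order.disp_t) (nu : orderType d) (nu_card : is_cardinal nu)
    (nu_large : ([set: set (set nat)] #<= [set: nu])%card)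
    (S : gSetType G) (rel : relations R S)
    (rel_wa : weakly_admissible nu rel) :
  exists (C : lmcGCstarType R G) (rho : S -> C),
    [/\ nu_complete nu C,
        is_grep rel rho,
        forall (B : lmcGCstarType R G) (sigma : S -> B),
          nu_complete nu B -> is_grep rel sigma ->
          exists! phi : C -> B, is_ghom phi /\ phi \o rho = sigma
      & forall B : lmcGCstarType R G, nu_complete nu B ->
          set_bij [set phi : C -> B | is_ghom phi]
                  [set sigma : S -> B | is_grep rel sigma]
                  (fun phi => phi \o rho)].
Proof.
have cC := univ_alg_complete nu rel.
have rhoP := univ_map_grep rel_wa.
exists (univ_alg nu rel), (univ_map nu rel).
have uniq (B : lmcGCstarType R G) (f h : univ_alg nu rel -> B) :
    hausdorff_space B -> is_ghom f -> is_ghom h ->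
    f \o univ_map nu rel = h \o univ_map nu rel -> f = h.
  exact: span_ghom_unique.
split=> // [B sigma cB sigmaP|B cB].
  have [phi phi_hom phiE] := univ_alg_extension rel_wa cB sigmaP.
  exists phi; split=> // psi [psi_hom psiE].
  by apply: uniq => //; [exact: cB.1|rewrite phiE psiE].
split.
- by move=> phi phi_hom; exact: (grep_comp rel_wa).
- by move=> f h /set_mem fP /set_mem hP; exact: uniq cB.1 fP hP.
- move=> sigma sigmaP.
  by have [phi phi_hom <-] := univ_alg_extension rel_wa cB sigmaP; exists phi.
Qed.
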